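(* Let $0<\phi<\pi$ and $\lambda>0$. The function of the second kind $Q_n^{(\lambda)}(z;\phi)$, defined for $\operatorname{Im}z\ne0$, satisfies the same lowering and raising relations as the Meixner--Pollaczek polynomials, that is $$T\,Q_n^{(\lambda)}(z;\phi)=2\sin\phi\;Q_{n-1}^{(\lambda+1/2)}(z;\phi),$$ $$T\left[\omega(z;\lambda,\phi)\,Q_n^{(\lambda)}(z;\phi)\right]=-(n+1)\,\omega(z;\lambda-\tfrac12,\phi)\,Q_{n+1}^{(\lambda-1/2)}(z;\phi),$$ where $n\ge 1$ in the first relation, and $n\ge0$ and $\lambda>\tfrac12$ in the second.
   Context: $T$ acts in the variable $z$ by $(Tf)(z)=\dfrac{f(z+i/2)-f(z-i/2)}{i}$. The weight function is $\omega(x;\lambda,\phi)=e^{(2\phi-\pi)x}\,|\Gamma(\lambda+ix)|^2$ for real $x$, continued to complex $z$ as $\omega(z;\lambda,\phi)=e^{(2\phi-\pi)z}\,\Gamma(\lambda+iz)\Gamma(\lambda-iz)$. The Meixner--Pollaczek polynomials are $$P_n^{(\lambda)}(x;\phi)=e^{in\phi}\sum_{k=0}^n\frac{(\lambda+ix)_k(\lambda-ix)_{n-k}}{k!\,(n-k)!}e^{-2ik\phi},\qquad n=0,1,2,\dots,$$ with $(\alpha)_0=1$, $(\alpha)_k=\alpha(\alpha+1)\cdots(\alpha+k-1)$; they are orthogonal on $\mathbb R$ with respect to $\omega(x;\lambda,\phi)\,dx$ and satisfy $TP_n^{(\lambda)}(x;\phi)=2\sin\phi\,P_{n-1}^{(\lambda+1/2)}(x;\phi)$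 and $T[\omega(x;\lambda,\phi)P_n^{(\lambda)}(x;\phi)]=-(n+1)\,\omega(x;\lambda-\tfrac12,\phi)\,P_{n+1}^{(\lambda-1/2)}(x;\phi)$. For $\operatorname{Im}z\ne0$ the function of the second kind $Q_n^{(\lambda)}(z;\phi)$ is defined by $$\omega(z;\lambda,\phi)\,Q_n^{(\lambda)}(z;\phi)=\int_{\mathbb R}\frac{P_n^{(\lambda)}(t;\phi)}{z-t}\,\omega(t;\lambda,\phi)\,dt .$$
   Formalization: The relations are stated for |Im z| > 1/2, where z+i/2 and z−i/2 lie in the same half-plane; for 0 < |Im z| < 1/2 they fail by a residue term proportional to P_n, and for |Im z| = 1/2 the left side is undefined. *)

(* Defs.v *)
From Stdlib Require Import Reals Factorial Lra.
From Coquelicot Require Import Coquelicot.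
Open Scope R_scope.
Open Scope C_scope.

Definition Cexp (z : C) : C :=
  (exp (Re z) * cos (Im z), exp (Re z) * sin (Im z))%R.

Fixpoint poch (a : C) (k : nat) : C :=
  match k with
  | O => 1
  | S j => poch a j * (a + INR j)
  end.

(* Gauss: Gamma(z) = lim_n  n! n^z / (z (z+1) ... (z+n)),  valid on all of
   C \ {0,-1,-2,...}.  At a pole z = -m the terms with n >= m are divisions by
   zero, hence 0 (Rinv_0), so that Gamma takes the value 0 there and  / Gamma z
   is the entire function 1/Gamma for every z. *)
Definition Gamma_seq (z : C) (n : nat) : C :=
  INR (fact n) * Cexp (z * ln (INR n)) / poch z (S n).

Definition Gamma (z : C) : C :=
  (real (Lim_seq (fun n => Re (Gamma_seq z n))),
   real (Lim_seq (fun n => Im (Gamma_seq z n)))).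

Definition omega (lam phi : R) (z : C) : C :=
  Cexp ((2 * phi - PI)%R * z) * Gamma (lam + Ci * z) * Gamma (lam - Ci * z).

(* z is not a pole of omega(.; lam, phi) *)
Definition omega_regular (lam : R) (z : C) : Prop :=
  forall k : nat, lam + Ci * z <> - INR k /\ lam - Ci * z <> - INR k.

Definition MP (lam phi : R) (n : nat) (x : C) : C :=
  Cexp (Ci * (INR n * phi)%R) *
  sum_n (fun k : nat =>
    poch (lam + Ci * x) k * poch (lam - Ci * x) (n - k)
      / (INR (fact k) * INR (fact (n - k)))
      * Cexp (- (Ci * (2 * INR k * phi)%R))) n.

Definition C_RInt_line (f : R -> C) : C :=
  RInt_gen (V := C_R_CompleteNormedModule) f
    (Rbar_locally m_infty) (Rbar_locally p_infty).

(* The product omega(z) Q(z), defined by the Cauchy integral for Im z <> 0; at a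
   pole of omega this is its value at the removable singularity. *)
Definition omegaQ (lam phi : R) (n : nat) (z : C) : C :=
  C_RInt_line (fun t : R => MP lam phi n t / (z - t) * omega lam phi t).

(* The solution Q of  omega(z) Q(z) = omegaQ(z).  The function 1/omega is entire
   and / omega is equal to it everywhere (see Gamma), so this is the holomorphic
   function Q on Im z <> 0, also at the poles of omega (where Q vanishes). *)
Definition Q (lam phi : R) (n : nat) (z : C) : C :=
  omegaQ lam phi n z / omega lam phi z.

(* Functions of the second kind live on the two half-planes Im z > 0 and
   Im z < 0 and jump across the real line, so T applies to them at the points z
   for which z + i/2 and z - i/2 are in the same half-plane: |Im z| > 1/2. *)
Definition T (f : C -> C) (z : C) : C :=
  (f (z + Ci / 2) - f (z - Ci / 2)) / Ci.

Lemma Cexp_conj (z : C) : Cexp (Cconj z) = Cconj (Cexp z).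
Proof.
destruct z as [x y]; unfold Cexp, Cconj; simpl.
rewrite cos_neg, sin_neg; f_equal; ring.
Qed.

Lemma poch_conj (a : C) (k : nat) : poch (Cconj a) k = Cconj (poch a k).
Proof.
induction k as [|k IH]; simpl.
- unfold Cconj; simpl; unfold RtoC; f_equal; ring.
- rewrite IH, Cmult_conj, Cplus_conj; do 2 f_equal.
  unfold Cconj, RtoC; simpl; f_equal; ring.
Qed.

Lemma Cinv_conj_total (z : C) : / Cconj z = Cconj (/ z).
Proof.
destruct z as [x y]; unfold Cinv, Cconj; simpl.
replace (x * (x * 1) + - y * (- y * 1))%R
  with (x * (x * 1) + y * (y * 1))%R by ring.
unfold Rdiv; f_equal; ring.
Qed.

Lemma Gamma_conj (z : C) : Gamma (Cconj z) = Cconj (Gamma z).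
Proof.
assert (H : forall n, Gamma_seq (Cconj z) n = Cconj (Gamma_seq z n)).
{ intros n; unfold Gamma_seq, Cdiv.
  assert (HR : forall r : R, RtoC r = Cconj r)
    by (intros r; unfold Cconj, RtoC; simpl; f_equal; ring).
  rewrite (HR (INR (fact n))), (HR (ln (INR n))).
  rewrite <- Cmult_conj, Cexp_conj, poch_conj, Cinv_conj_total.
  rewrite <- !Cmult_conj, <- !HR; reflexivity. }
assert (Hre : Lim_seq (fun n => Re (Gamma_seq (Cconj z) n))
              = Lim_seq (fun n => Re (Gamma_seq z n))).
{ apply Lim_seq_ext; intros n; rewrite H; reflexivity. }
assert (Him : Lim_seq (fun n => Im (Gamma_seq (Cconj z) n))
              = Rbar_opp (Lim_seq (fun n => Im (Gamma_seq z n)))).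
{ rewrite <- Lim_seq_opp.
  apply Lim_seq_ext; intros n; rewrite H; reflexivity. }
unfold Gamma; rewrite Hre, Him, Rbar_opp_real; reflexivity.
Qed.

(* On the real line omega is the weight exp((2 phi - pi) x) |Gamma(lam + i x)|^2. *)
Lemma omega_real (lam phi x : R) :
  omega lam phi x =
  RtoC (exp ((2 * phi - PI) * x) * Cmod (Gamma (lam + Ci * x)) ^ 2)%R.
Proof.
unfold omega.
replace (lam - Ci * x) with (Cconj (lam + Ci * x))
  by (unfold Cconj, Cminus, Cplus, Copp, Cmult, Ci, RtoC; simpl; f_equal; ring).
rewrite Gamma_conj.
destruct (Gamma (lam + Ci * x)) as [u v].
assert (Hm : (Cmod (u, v) ^ 2 = u ^ 2 + v ^ 2)%R).
{ unfold Cmod; simpl fst; simpl snd.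
  apply pow2_sqrt; nra. }
rewrite Hm.
unfold Cexp, Cconj, Cmult, RtoC; simpl.
replace ((2 * phi - PI) * 0 + 0 * x)%R with 0%R by ring.
replace ((2 * phi - PI) * x - 0 * 0)%R with ((2 * phi - PI) * x)%R by ring.
rewrite cos_0, sin_0; f_equal; ring.
Qed.

(* Main.v *)
Require Import Defs.
From Stdlib Require Import Reals Factorial Lra Lia Psatz.
From Coquelicot Require Import Coquelicot.
Open Scope R_scope.
Open Scope C_scope.

(* Since [1/(z + i/2 - t)] is [1/(z - s)] at [t = s + i/2], the operator [T] applied to
   the Cauchy integral of [omega P_n] becomes, after moving the line of integration to
   [Im t = 1/2] in one term and to [Im t = -1/2] in the other, the Cauchy integral of
   [T (omega P_n)]; this is the raising relation.  The weight is holomorphic on the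
   strips that are crossed, and its exponential decay (rate [pi - |2 phi - pi|]) removes
   the vertical sides.  For the lowering relation, [1 / omega(z +- i/2; lam)] is
   [1 / omega(z; lam + 1/2)] up to a factor linear in [z]; orthogonality of [P_n] to the
   constants lets one replace [z] by [t -+ i/2] in that factor, which then turns the
   weight into one for which the same shift gives [omega(s; lam + 1/2)].

   Only Gauss's limit is available for Gamma.  Its partial products converge uniformly
   on compact subsets of [Re z > 0], so Cauchy's theorem is applied to them and passed to
   the limit; comparing the product for [|Gamma(s + i y) / Gamma(s)|^2] with the integral
   of [ln (1 + y^2 / u^2)] gives the decay [exp (- pi |y|)]. *)

(** * The complex exponential and complex limits *)

(** The lowering relation is claimed for all lam > 0, and for lam <= 1/2 the weight omega(t; lam)
    has a pole at t = i lam, inside the strip 0 <= Im t <= 1/2, so the line cannot be moved at once.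
    The linear factor removes this obstacle: written as lam + i t, it turns Gamma(lam + i t) into
    Gamma(lam + 1 + i t), whose poles lie beyond the strip. In the lower strip lam - i t does the
    same for the other Gamma factor. The two Gamma parameters thereby become unequal, whence
    [weight a b phi]. Orthogonality to the constants is itself a contour shift: the raising relation
    at lam + 1/2, integrated without a Cauchy kernel. The condition |Im z| > 1/2 keeps the poles z +
    i/2 and z - i/2 of the kernels out of the strips that are crossed. Since [Gamma] is 0 at its
    poles, [/ omega] satisfies its recursions everywhere and the lowering relation has no
    exceptional points. The product [omega * Q], on the contrary, is 0 at a pole of omega, while
    [omegaQ] keeps the value at the removable singularity; this is why the raising relation is
    proved for [omegaQ] and transferred to the product at regular points. *)

Lemma Cmod_le_abs (z : C) : (Cmod z <= Rabs (Re z) + Rabs (Im z))%R.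
Proof.
assert (H := Cmod_ge_0 z); assert (H2 := Cmod2_alt z).
assert (H3 := Rabs_pos (Re z)); assert (H4 := Rabs_pos (Im z)).
rewrite <- (pow2_abs (Re z)), <- (pow2_abs (Im z)) in H2; nra.
Qed.

Lemma Rabs_im_le_Cmod (z : C) : (Rabs (Im z) <= Cmod z)%R.
Proof.
assert (H := Cmod_ge_0 z); assert (H2 := Cmod2_alt z).
assert (H4 := Rabs_pos (Im z)); rewrite <- (pow2_abs (Im z)) in H2; nra.
Qed.

Lemma Cmod_minus_sym (z w : C) : Cmod (z - w) = Cmod (w - z).
Proof. rewrite <- Cmod_opp; f_equal; ring. Qed.

Lemma Cmod_triangle_minus (a b c : C) :
  (Cmod (a - c) <= Cmod (a - b) + Cmod (b - c))%R.
Proof.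
replace (a - c) with ((a - b) + (b - c)) by ring; apply Cmod_triangle.
Qed.

Lemma Cmod_minus_lower (a b : C) : (Cmod a - Cmod b <= Cmod (a - b))%R.
Proof.
assert (H := Cmod_triangle (a - b) b).
replace (a - b + b) with a in H by ring; lra.
Qed.

Lemma Cinv_zero : / (0 : C) = 0.
Proof. unfold Cinv; simpl; apply injective_projections; simpl; unfold Rdiv; ring. Qed.

(** By the convention [/ 0 = 0] there is no nonvanishing condition, so reciprocals of the weight can
    be rearranged even where it has poles and [Gamma] takes the value 0. *)
Lemma Cinv_mult_total (a b : C) : / (a * b) = / a * / b.
Proof.
destruct (Ceq_dec a 0) as [->|Ha]; [rewrite Cmult_0_l, Cinv_zero; ring|].
destruct (Ceq_dec b 0) as [->|Hb]; [rewrite Cmult_0_r, Cinv_zero; ring|].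
field; auto.
Qed.

Lemma Cmod_inv_total (a : C) : Cmod (/ a) = (/ Cmod a)%R.
Proof.
destruct (Ceq_dec a 0) as [->|Ha]; [|now apply Cmod_inv].
now rewrite Cinv_zero, Cmod_0, Rinv_0.
Qed.

Lemma Cmod_Cexp (z : C) : Cmod (Cexp z) = exp (Re z).
Proof.
assert (H := Cmod_ge_0 (Cexp z)); assert (H1 := exp_pos (Re z)).
assert (H2 := Cmod2_alt (Cexp z)); unfold Cexp in H2; simpl in H2.
assert (H3 := sin2_cos2 (Im z)); unfold Rsqr in H3.
assert (Cmod (Cexp z) ^ 2 = exp (Re z) ^ 2)%R.
{ unfold Cexp; simpl; rewrite H2.
  transitivity (exp (Re z) ^ 2 * (sin (Im z) * sin (Im z) + cos (Im z) * cos (Im z)))%R;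
  [ring | rewrite H3; ring]. }
nra.
Qed.

Lemma Cexp_plus (z w : C) : Cexp (z + w) = Cexp z * Cexp w.
Proof.
destruct z as [x y], w as [u v]; unfold Cexp; simpl.
rewrite exp_plus, cos_plus, sin_plus.
apply injective_projections; simpl; ring.
Qed.

Lemma Cexp_R (x : R) : Cexp (RtoC x) = RtoC (exp x).
Proof.
unfold Cexp; simpl; rewrite cos_0, sin_0.
apply injective_projections; simpl; ring.
Qed.

Lemma Cexp_0 : Cexp 0 = 1.
Proof. rewrite Cexp_R, exp_0; reflexivity. Qed.

Lemma Cexp_neq_0 (z : C) : Cexp z <> 0.
Proof. apply Cmod_gt_0; rewrite Cmod_Cexp; apply exp_pos. Qed.

Lemma Cexp_opp (z : C) : Cexp (- z) = / Cexp z.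
Proof.
assert (H := Cexp_neq_0 z).
assert (H1 : Cexp (- z) * Cexp z = 1).
{ rewrite <- Cexp_plus, <- Cexp_0; f_equal; ring. }
replace (Cexp (- z)) with (Cexp (- z) * Cexp z * / Cexp z) by (field; auto).
rewrite H1; ring.
Qed.

(** Taylor remainders are obtained from this one order at a time: the bound for a remainder is fed
    in as the bound on the derivative of the next one. The constants are not sharp. *)
Lemma MVT_abs_bound (f df : R -> R) (M x : R) :
  (forall t, is_derive f t (df t)) ->
  (forall t, Rabs t <= Rabs x -> Rabs (df t) <= M)%R ->
  (Rabs (f x - f 0) <= M * Rabs x)%R.
Proof.
intros Hd HM.
destruct (MVT_gen f 0 x df) as [c [Hc E]].
- intros t _; apply Hd.
- intros t _; apply continuity_pt_filterlim.
  apply (ex_derive_continuous (V := R_NormedModule) f).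
  exists (df t); apply Hd.
- rewrite E, Rabs_mult, Rminus_0_r; apply Rmult_le_compat_r; [apply Rabs_pos|].
  apply HM; revert Hc; unfold Rmin, Rmax, Rabs.
  destruct (Rle_dec 0 x), (Rcase_abs c), (Rcase_abs x); lra.
Qed.

Lemma Rabs_sin_le (y : R) : (Rabs (sin y) <= Rabs y)%R.
Proof.
assert (H := MVT_abs_bound sin cos 1 y).
rewrite sin_0, Rminus_0_r, Rmult_1_l in H; apply H.
- intros t; apply is_derive_sin.
- intros t _; apply Rabs_le, COS_bound.
Qed.

Lemma Rabs_cos_minus_1_le (y : R) : (Rabs (cos y - 1) <= Rabs y * Rabs y)%R.
Proof.
assert (H := MVT_abs_bound cos (fun t => - sin t)%R (Rabs y) y).
rewrite cos_0 in H; apply H.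
- intros t; apply is_derive_cos.
- intros t Ht; rewrite Rabs_Ropp; apply Rle_trans with (2 := Ht), Rabs_sin_le.
Qed.

Lemma Rabs_sin_minus_id_le (y : R) : (Rabs (sin y - y) <= Rabs y * Rabs y * Rabs y)%R.
Proof.
assert (H := MVT_abs_bound (fun t => sin t - t)%R (fun t => cos t - 1)%R
  (Rabs y * Rabs y) y).
cbv beta in H; rewrite sin_0, Rminus_0_r, Rminus_0_r in H; apply H.
- intros t; auto_derive; [exact I | ring].
- intros t Ht; apply Rle_trans with (1 := Rabs_cos_minus_1_le t).
  assert (H0 := Rabs_pos t); nra.
Qed.

Lemma exp_monotone (x y : R) : (x <= y)%R -> (exp x <= exp y)%R.
Proof. intros [H | ->]; [left; now apply exp_increasing | lra]. Qed.

Lemma exp_le_exp_abs (t x : R) : (Rabs t <= Rabs x -> exp t <= exp (Rabs x))%R.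
Proof. intros H; apply exp_monotone; assert (H1 := Rle_abs t); lra. Qed.

Lemma Rabs_exp_minus_1_le (x : R) : (Rabs (exp x - 1) <= exp (Rabs x) * Rabs x)%R.
Proof.
assert (H := MVT_abs_bound exp exp (exp (Rabs x)) x).
rewrite exp_0 in H; apply H.
- intros t; apply is_derive_exp.
- intros t Ht; rewrite Rabs_right; [now apply exp_le_exp_abs|].
  left; apply exp_pos.
Qed.

Lemma Rabs_exp_remainder_le (x : R) :
  (Rabs (exp x - 1 - x) <= exp (Rabs x) * Rabs x * Rabs x)%R.
Proof.
assert (H := MVT_abs_bound (fun t => exp t - t)%R (fun t => exp t - 1)%R
  (exp (Rabs x) * Rabs x) x).
cbv beta in H; rewrite exp_0 in H.
replace (exp x - 1 - x)%R with (exp x - x - (1 - 0))%R by ring; apply H.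
- intros t; auto_derive; [exact I | ring].
- intros t Ht; apply Rle_trans with (1 := Rabs_exp_minus_1_le t).
  apply Rmult_le_compat; auto using Rabs_pos.
  left; apply exp_pos.
  apply exp_monotone, Ht.
Qed.

(** The real and imaginary parts contribute [2 * (r ^ 2 * exp r)] each. The estimate serves twice:
    for the ratio of consecutive Gauss products, and for the differentiability of [Cexp] in
    [C11_Cexp]. *)
Lemma Cexp_remainder_le (z : C) :
  (Cmod (Cexp z - 1 - z) <= 4 * Cmod z ^ 2 * exp (Cmod z))%R.
Proof.
apply Rle_trans with (1 := Cmod_le_abs _).
assert (Hx := re_le_Cmod z); assert (Hy := Rabs_im_le_Cmod z).
destruct z as [x y]; unfold Cexp.
set (r := Cmod (x, y)) in *; simpl in Hx, Hy; simpl.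
assert (E1 : (1 <= exp (Rabs x))%R) by (rewrite <- exp_0; apply exp_monotone, Rabs_pos).
assert (E2 : (exp (Rabs x) <= exp r)%R) by now apply exp_monotone.
assert (E3 : (Rabs y <= exp r)%R).
{ apply Rle_trans with (1 := Hy); assert (H := exp_ineq1_le r); lra. }
assert (Px := Rabs_pos x); assert (Py := Rabs_pos y).
assert (A1 := Rabs_exp_remainder_le x); assert (A2 := Rabs_cos_minus_1_le y).
assert (A3 := Rabs_exp_minus_1_le x); assert (A4 := Rabs_sin_minus_id_le y).
assert (A5 := Rabs_sin_le y).
assert (Sx : (Rabs x * Rabs x <= r ^ 2)%R) by nra.
assert (Sy : (Rabs y * Rabs y <= r ^ 2)%R) by nra.
assert (Sxy : (Rabs x * Rabs y <= r ^ 2)%R) by nra.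
assert (B1 : (Rabs (exp x * cos y + - (1) + - x) <= 2 * (r ^ 2 * exp r))%R).
{ replace (exp x * cos y + - (1) + - x)%R
    with ((exp x - 1 - x) + exp x * (cos y - 1))%R by ring.
  apply Rle_trans with (1 := Rabs_triang _ _); rewrite Rabs_mult.
  rewrite (Rabs_right (exp x)) by (left; apply exp_pos).
  assert (exp x <= exp r)%R by (apply exp_monotone; assert (H := Rle_abs x); lra).
  assert (0 < exp x)%R by apply exp_pos.
  assert (exp (Rabs x) * Rabs x * Rabs x <= exp r * r ^ 2)%R by nra.
  assert (exp x * Rabs (cos y - 1) <= exp r * r ^ 2)%R.
  { apply Rmult_le_compat; auto using Rabs_pos; lra. }
  lra. }
assert (B2 : (Rabs (exp x * sin y + - 0 + - y) <= 2 * (r ^ 2 * exp r))%R).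
{ replace (exp x * sin y + - 0 + - y)%R
    with ((exp x - 1) * sin y + (sin y - y))%R by ring.
  apply Rle_trans with (1 := Rabs_triang _ _); rewrite Rabs_mult.
  assert (Rabs (exp x - 1) * Rabs (sin y) <= exp r * r ^ 2)%R.
  { apply Rle_trans with ((exp (Rabs x) * Rabs x) * Rabs y)%R.
    - apply Rmult_le_compat; auto using Rabs_pos.
    - assert (0 <= Rabs x * Rabs y)%R by nra; nra. }
  assert (Rabs y * Rabs y * Rabs y <= exp r * r ^ 2)%R.
  { rewrite Rmult_comm; apply Rmult_le_compat; nra. }
  lra. }
lra.
Qed.

Definition is_Clim (u : nat -> C) (l : C) : Prop :=
  forall eps : R, (0 < eps)%R ->
  exists N : nat, forall n, (N <= n)%nat -> (Cmod (u n - l) <= eps)%R.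

Lemma is_Clim_Re (u : nat -> C) (l : C) :
  is_Clim u l -> is_lim_seq (fun n => Re (u n)) (Re l).
Proof.
intros H; apply is_lim_seq_spec; intros [eps Heps].
destruct (H (eps / 2)%R) as [N HN]; [lra|]; exists N; intros n Hn; simpl.
assert (H1 := re_le_Cmod (u n - l)); specialize (HN n Hn).
destruct (u n), l; simpl in *; unfold Rminus; lra.
Qed.

Lemma is_Clim_Im (u : nat -> C) (l : C) :
  is_Clim u l -> is_lim_seq (fun n => Im (u n)) (Im l).
Proof.
intros H; apply is_lim_seq_spec; intros [eps Heps].
destruct (H (eps / 2)%R) as [N HN]; [lra|]; exists N; intros n Hn; simpl.
assert (H1 := Rabs_im_le_Cmod (u n - l)); specialize (HN n Hn).
destruct (u n), l; simpl in *; unfold Rminus; lra.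
Qed.

(** [Lim_seq] has a value for every real sequence, so [Gamma z] is informative only once the Gauss
    sequence is known to converge. *)
Lemma Gamma_of_is_Clim (z l : C) : is_Clim (Gamma_seq z) l -> Gamma z = l.
Proof.
intros H; unfold Gamma.
rewrite (is_lim_seq_unique _ _ (is_Clim_Re _ _ H)).
rewrite (is_lim_seq_unique _ _ (is_Clim_Im _ _ H)).
now destruct l.
Qed.

Lemma Clim_cauchy (u : nat -> C) :
  (forall eps : R, (0 < eps)%R -> exists N : nat,
     forall n m, (N <= n)%nat -> (n <= m)%nat -> (Cmod (u m - u n) <= eps)%R) ->
  exists l, is_Clim u l.
Proof.
intros H.
assert (HC : forall p : C -> R, (forall z w, Rabs (p z - p w) <= Cmod (z - w))%R ->
   { l : R | Un_cv (fun n => p (u n)) l}).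
{ intros p Hp; apply Rcomplete.R_complete; intros eps Heps.
  destruct (H (eps / 2)%R) as [N HN]; [lra|]; exists N.
  intros n m Hn Hm; unfold R_dist; apply Rle_lt_trans with (1 := Hp _ _).
  destruct (Nat.le_ge_cases n m) as [L|L].
  - rewrite Cmod_minus_sym; specialize (HN n m Hn L); lra.
  - specialize (HN m n Hm L); lra. }
destruct (HC Re) as [a Ha].
{ intros z w; assert (E := re_le_Cmod (z - w)); destruct z, w; exact E. }
destruct (HC Im) as [b Hb].
{ intros z w; assert (E := Rabs_im_le_Cmod (z - w)); destruct z, w; exact E. }
exists (a, b); intros eps Heps.
destruct (Ha (eps / 2)%R) as [N1 H1]; [lra|].
destruct (Hb (eps / 2)%R) as [N2 H2]; [lra|].
exists (N1 + N2)%nat; intros n Hn; apply Rle_trans with (1 := Cmod_le_abs _).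
specialize (H1 n ltac:(lia)); specialize (H2 n ltac:(lia)).
unfold R_dist in *; destruct (u n); simpl in *; unfold Rminus in *; lra.
Qed.

Lemma is_Clim_ext_ev (u v : nat -> C) (l : C) (N : nat) :
  (forall n, (N <= n)%nat -> u n = v n) -> is_Clim u l -> is_Clim v l.
Proof.
intros E H eps Heps; destruct (H eps Heps) as [M HM].
exists (N + M)%nat; intros n Hn; rewrite <- E by lia; apply HM; lia.
Qed.

Lemma is_Clim_const (l : C) : is_Clim (fun _ => l) l.
Proof.
intros eps Heps; exists O; intros n _.
replace (l - l) with (0 : C) by ring; rewrite Cmod_0; lra.
Qed.

Lemma is_Clim_mult (u v : nat -> C) (a b : C) :
  is_Clim u a -> is_Clim v b -> is_Clim (fun n => u n * v n) (a * b).
Proof.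
intros Hu Hv eps Heps.
assert (Pa := Cmod_ge_0 a); assert (Pb := Cmod_ge_0 b).
set (d := (eps / (2 * (Cmod a + Cmod b + 1 + eps)))%R).
assert (Hd : (0 < d)%R) by (apply Rdiv_lt_0_compat; lra).
assert (Ed : (d * (2 * (Cmod a + Cmod b + 1 + eps)) = eps)%R)
  by (unfold d; field; lra).
assert (d < 1)%R by nra.
destruct (Hu d Hd) as [N1 H1]; destruct (Hv d Hd) as [N2 H2].
exists (N1 + N2)%nat; intros n Hn.
specialize (H1 n ltac:(lia)); specialize (H2 n ltac:(lia)).
replace (u n * v n - a * b)
  with ((u n - a) * (v n - b) + (a * (v n - b) + (u n - a) * b)) by ring.
apply Rle_trans with (1 := Cmod_triangle _ _).
assert (H3 := Cmod_triangle (a * (v n - b)) ((u n - a) * b)).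
rewrite !Cmod_mult in *.
assert (P1 := Cmod_ge_0 (u n - a)); assert (P2 := Cmod_ge_0 (v n - b)).
assert (Cmod (u n - a) * Cmod (v n - b) <= d * 1)%R by (apply Rmult_le_compat; lra).
assert (Cmod a * Cmod (v n - b) <= Cmod a * d)%R by (apply Rmult_le_compat_l; lra).
assert (Cmod (u n - a) * Cmod b <= d * Cmod b)%R by (apply Rmult_le_compat_r; lra).
nra.
Qed.

Lemma is_Clim_of_inv (u : nat -> C) (l : C) (K : R) (N : nat) :
  (forall n, (N <= n)%nat -> (1 <= n)%nat -> (Cmod (u n - l) <= K / INR n)%R) ->
  is_Clim u l.
Proof.
intros H eps Heps; destruct (nfloor_ex (Rmax 0 (K / eps))) as [M [HM1 HM2]];
  [apply Rmax_l|].
assert (HM3 := Rmax_r 0 (K / eps)).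
exists (S (M + N)); intros n Hn; apply Rle_trans with (K / INR n)%R.
- apply H; lia.
- assert (HI : (INR (S M) <= INR n)%R) by (apply le_INR; lia).
  rewrite S_INR in HI; assert (HMp := pos_INR M).
  apply Rle_div_l; [lra|].
  replace K with (K / eps * eps)%R by (field; lra).
  rewrite Rmult_comm; apply Rmult_le_compat_l; lra.
Qed.

(** * The Gauss sequence and the Gamma function *)

Lemma Re_RtoC_plus (z : C) (x : R) : Re (z + x) = (Re z + x)%R.
Proof. destruct z; reflexivity. Qed.

Lemma Cneq_0_Re (z : C) : (0 < Re z)%R -> z <> 0.
Proof. intros H E; rewrite E in H; simpl in H; lra. Qed.

Lemma Re_le_Cmod (z : C) : (Re z <= Cmod z)%R.
Proof. apply Rle_trans with (2 := re_le_Cmod z), Rle_abs. Qed.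

Lemma poch_neq_0 (a : C) (k : nat) : (0 < Re a)%R -> poch a k <> 0.
Proof.
intros H; induction k as [|k IH]; simpl.
- intros E; injection E; lra.
- apply Cmult_neq_0; [exact IH|]; apply Cneq_0_Re; rewrite Re_RtoC_plus.
  assert (H1 := pos_INR k); lra.
Qed.

Lemma poch_S_l (a : C) (k : nat) : poch a (S k) = a * poch (a + 1) k.
Proof.
induction k as [|k IH]; [simpl; ring|].
change (poch a (S (S k))) with (poch a (S k) * (a + INR (S k))).
rewrite IH; change (poch (a + 1) (S k)) with (poch (a + 1) k * (a + 1 + INR k)).
rewrite S_INR, RtoC_plus; ring.
Qed.

Lemma INR_neq_0_C (n : nat) : (1 <= n)%nat -> RtoC (INR n) <> 0.
Proof. intros H E; injection E; apply not_0_INR; lia. Qed.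

(** Both bounds are [1 + u <= exp u], taken at the logarithm of (n + 1) / n and at its opposite. *)
Lemma ln_succ_bounds (n : nat) : (1 <= n)%nat ->
  (/ INR (S n) <= ln (INR (S n)) - ln (INR n) <= / INR n)%R.
Proof.
intros Hn; assert (H0 : (0 < INR n)%R) by (apply lt_0_INR; lia).
assert (H1 : (0 < INR (S n))%R) by (apply lt_0_INR; lia).
set (u := (ln (INR (S n)) - ln (INR n))%R).
assert (E1 := exp_ineq1_le u); assert (E2 := exp_ineq1_le (- u)%R).
assert (F1 : exp u = (INR (S n) / INR n)%R).
{ unfold u; rewrite <- ln_div by auto; apply exp_ln, Rdiv_lt_0_compat; auto. }
rewrite exp_Ropp, F1 in E2; rewrite F1 in E1.
replace (INR (S n) / INR n)%R with (1 + / INR n)%R in E1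
  by (rewrite S_INR; field; lra).
replace (/ (INR (S n) / INR n))%R with (1 - / INR (S n))%R in E2
  by (rewrite S_INR in *; field; lra).
lra.
Qed.

Lemma Gamma_seq_S (z : C) (n : nat) : (0 < Re z)%R -> (1 <= n)%nat ->
  Gamma_seq z (S n) * (z + INR (S n)) =
  Gamma_seq z n * (INR (S n) * Cexp (z * (ln (INR (S n)) - ln (INR n))%R)).
Proof.
intros Hz Hn; unfold Gamma_seq.
replace (z * ln (INR (S n)))
  with (z * ln (INR n) + z * (ln (INR (S n)) - ln (INR n))%R)
  by (rewrite RtoC_minus; ring).
rewrite Cexp_plus.
change (poch z (S (S n))) with (poch z (S n) * (z + INR (S n))).
replace (fact (S n)) with (S n * fact n)%nat by reflexivity.
rewrite mult_INR, RtoC_mult.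
assert (H1 : z + INR (S n) <> 0)
  by (apply Cneq_0_Re; rewrite Re_RtoC_plus; assert (H := pos_INR (S n)); lra).
assert (H2 := poch_neq_0 z (S n) Hz).
set (p := poch z (S n)) in *; set (x := RtoC (INR (S n))) in *.
field; auto.
Qed.

(** The two summands bound the exponential remainder and the term z ((n + 1) u - 1) in
    [Gamma_seq_step]; the factor 2 comes from 1 / n^2 <= 2 (1 / n - 1 / (n + 1)). *)
Definition gauss_const (B : R) : R := (2 * (4 * B ^ 2 * exp B + B))%R.

Lemma gauss_const_pos (B : R) : (0 <= B -> 0 <= gauss_const B)%R.
Proof.
intros H; unfold gauss_const; assert (H1 := exp_pos B).
assert (0 <= B ^ 2 * exp B)%R by (apply Rmult_le_pos; nra); lra.
Qed.

(** The ratio of consecutive Gauss products is 1 + O(1 / n^2), uniformly for [Cmod z <= B]. Writing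
    the error as a difference of reciprocals makes it telescope. *)
Lemma Gamma_seq_step (z : C) (B : R) (n : nat) :
  (0 < Re z)%R -> (Cmod z <= B)%R -> (1 <= n)%nat ->
  (Cmod (Gamma_seq z (S n) - Gamma_seq z n)
   <= Cmod (Gamma_seq z n) * (gauss_const B * (/ INR n - / INR (S n))))%R.
Proof.
intros Hz HB Hn.
assert (H0 : (1 <= INR n)%R) by (change 1%R with (INR 1); apply le_INR; lia).
assert (HN : INR (S n) = (INR n + 1)%R) by apply S_INR.
assert (Hu := ln_succ_bounds n Hn).
set (u := (ln (INR (S n)) - ln (INR n))%R) in *.
assert (HB0 : (0 <= B)%R) by (assert (H := Cmod_ge_0 z); lra).
assert (Hw : z + INR (S n) <> 0).
{ apply Cneq_0_Re; rewrite Re_RtoC_plus; lra. }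
(* The numerator (n + 1) exp(z u) - (n + 1) - z is regrouped into two terms of size O(1 / n), using
   that u is close to 1 / (n + 1). *)
assert (E : Gamma_seq z (S n) - Gamma_seq z n =
  Gamma_seq z n * ((INR (S n) * (Cexp (z * u) - 1 - z * u)
     + z * (INR (S n) * u - 1)%R) / (z + INR (S n)))).
{ assert (H := Gamma_seq_S z n Hz Hn); fold u in H.
  replace (Gamma_seq z (S n))
    with (Gamma_seq z (S n) * (z + INR (S n)) / (z + INR (S n))) by (field; auto).
  rewrite H, RtoC_minus, RtoC_mult; field; auto. }
rewrite E, Cmod_mult; apply Rmult_le_compat_l; [apply Cmod_ge_0|].
rewrite Cmod_div by auto.
assert (Hden : (INR n + 1 <= Cmod (z + INR (S n)))%R).
{ apply Rle_trans with (2 := Re_le_Cmod _); rewrite Re_RtoC_plus; lra. }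
assert (Ipos : (0 < / INR n)%R) by (apply Rinv_0_lt_compat; lra).
assert (Ile : (/ INR n <= 1)%R) by (rewrite <- Rinv_1; apply Rinv_le_contravar; lra).
assert (Ipos' : (0 < / INR (S n))%R) by (apply Rinv_0_lt_compat; lra).
assert (IN : (INR n * / INR n = 1)%R) by (field; lra).
assert (ISN : ((INR n + 1) * / INR (S n) = 1)%R) by (rewrite HN; field; lra).
assert (HZu : (Cmod (z * u) <= B * / INR n)%R).
{ rewrite Cmod_mult, Cmod_R, Rabs_right by lra.
  apply Rmult_le_compat; try lra; apply Cmod_ge_0. }
assert (HR := Cexp_remainder_le (z * u)).
assert (HP := Cmod_ge_0 (z * u)).
assert (He : (exp (Cmod (z * u)) <= exp B)%R) by (apply exp_monotone; nra).
assert (Hep := exp_pos (Cmod (z * u))).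
assert (HR2 : (Cmod (Cexp (z * u) - 1 - z * u) <= 4 * B ^ 2 * exp B * (/ INR n * / INR n))%R).
{ apply Rle_trans with (1 := HR).
  assert (Cmod (z * u) ^ 2 <= B ^ 2 * (/ INR n * / INR n))%R.
  { replace (B ^ 2 * (/ INR n * / INR n))%R with ((B * / INR n) ^ 2)%R by ring.
    apply pow_incr; lra. }
  assert (Cmod (z * u) ^ 2 * exp (Cmod (z * u)) <= B ^ 2 * (/ INR n * / INR n) * exp B)%R
    by (apply Rmult_le_compat; nra).
  lra. }
assert (HR3 : (Cmod (z * (INR (S n) * u - 1)%R) <= B * / INR n)%R).
{ rewrite Cmod_mult, Cmod_R; apply Rmult_le_compat; auto using Cmod_ge_0, Rabs_pos.
  rewrite Rabs_right; nra. }
assert (Hnum : (Cmod (INR (S n) * (Cexp (z * u) - 1 - z * u)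
   + z * (INR (S n) * u - 1)%R) <= (INR n + 1) * ((4 * B ^ 2 * exp B + B) * (/ INR n * / INR n)))%R).
{ apply Rle_trans with (1 := Cmod_triangle _ _).
  rewrite Cmod_mult, Cmod_R, Rabs_right by lra.
  assert (INR (S n) * Cmod (Cexp (z * u) - 1 - z * u)
    <= (INR n + 1) * (4 * B ^ 2 * exp B * (/ INR n * / INR n)))%R
    by (rewrite HN; apply Rmult_le_compat_l; lra).
  assert (B * / INR n <= (INR n + 1) * (B * (/ INR n * / INR n)))%R.
  { replace ((INR n + 1) * (B * (/ INR n * / INR n)))%R
      with (B * / INR n * (INR n * / INR n) + B * (/ INR n * / INR n))%R by ring.
    rewrite IN; assert (0 <= B * (/ INR n * / INR n))%R by (apply Rmult_le_pos; nra); lra. }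
  lra. }
set (K := (4 * B ^ 2 * exp B + B)%R) in *.
assert (HK : (0 <= K)%R) by (assert (H := gauss_const_pos B HB0); unfold gauss_const in H; fold K in H; lra).
apply Rle_trans with (K * (/ INR n * / INR n))%R.
- apply Rle_div_l; [lra|].
  apply Rle_trans with (1 := Hnum).
  rewrite Rmult_comm; apply Rmult_le_compat_l; [apply Rmult_le_pos; nra | lra].
- unfold gauss_const; fold K.
  assert (/ INR n * / INR n <= 2 * (/ INR n - / INR (S n)))%R.
  { replace (/ INR n - / INR (S n))%R with (/ INR n * / INR (S n))%R
      by (rewrite HN; field; lra). 
    assert (/ INR n <= 2 * / INR (S n))%R; [|nra].
    apply Rmult_le_reg_r with (INR n); [lra|].
    apply Rmult_le_reg_r with (INR n + 1)%R; [lra|].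
    replace (/ INR n * INR n * (INR n + 1))%R with (INR n + 1)%R by (field; lra).
    replace (2 * / INR (S n) * INR n * (INR n + 1))%R with (2 * INR n)%R
      by (rewrite HN; field; lra).
    lra. }
  nra.
Qed.

(** A discrete Gronwall inequality: a product of factors 1 + c_k is at most the exponential of the
    sum of the c_k, and here that sum telescopes. *)
Lemma telescoping_growth (u : nat -> C) (K : R) : (0 <= K)%R ->
  (forall n, (1 <= n)%nat ->
     (Cmod (u (S n) - u n) <= Cmod (u n) * (K * (/ INR n - / INR (S n))))%R) ->
  forall n m, (1 <= n)%nat -> (n <= m)%nat ->
  (Cmod (u m) <= Cmod (u n) * exp (K * (/ INR n - / INR m)))%R /\
  (Cmod (u m - u n) <= Cmod (u n) * exp K * (K * (/ INR n - / INR m)))%R.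
Proof.
intros HK Hstep n m Hn Hnm; induction Hnm as [|m Hnm IH].
- rewrite !Rminus_diag, !Rmult_0_r, exp_0.
  replace (u n - u n) with (0 : C) by ring; rewrite Cmod_0; split; lra.
- destruct IH as [IH1 IH2].
  assert (Hm := Hstep m ltac:(lia)).
  assert (Pn := Cmod_ge_0 (u n)); assert (Pm := Cmod_ge_0 (u m)).
  assert (I1 : (1 <= INR n)%R) by (change 1%R with (INR 1); apply le_INR; lia).
  assert (I2 : (INR n <= INR m)%R) by (apply le_INR; lia).
  assert (I3 : (INR m <= INR (S m))%R) by (apply le_INR; lia).
  assert (J1 : (/ INR m <= / INR n)%R) by (apply Rinv_le_contravar; lra).
  assert (J2 : (/ INR (S m) <= / INR m)%R) by (apply Rinv_le_contravar; lra).
  assert (J3 : (0 < / INR (S m))%R) by (apply Rinv_0_lt_compat; lra).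
  assert (J4 : (/ INR n <= 1)%R) by (rewrite <- Rinv_1; apply Rinv_le_contravar; lra).
  assert (HE := exp_ineq1_le (K * (/ INR m - / INR (S m)))%R).
  assert (HP := exp_pos (K * (/ INR n - / INR m))%R).
  split.
  + assert (H1 := Cmod_triangle (u m) (u (S m) - u m)).
    replace (u m + (u (S m) - u m)) with (u (S m)) in H1 by ring.
    apply Rle_trans with (Cmod (u m) * exp (K * (/ INR m - / INR (S m))))%R.
    { apply Rle_trans with (Cmod (u m) * (1 + K * (/ INR m - / INR (S m))))%R; [lra|].
      apply Rmult_le_compat_l; lra. }
    replace (K * (/ INR n - / INR (S m)))%R
      with (K * (/ INR n - / INR m) + K * (/ INR m - / INR (S m)))%R by ring.
    rewrite exp_plus, <- Rmult_assoc; apply Rmult_le_compat_r; [|exact IH1].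
    left; apply exp_pos.
  + apply Rle_trans with (1 := Cmod_triangle_minus _ (u m) _).
    assert (Cmod (u m) <= Cmod (u n) * exp K)%R.
    { apply Rle_trans with (1 := IH1), Rmult_le_compat_l; [lra|].
      apply exp_monotone; nra. }
    assert (0 <= K * (/ INR m - / INR (S m)))%R by (apply Rmult_le_pos; lra).
    assert (Cmod (u m) * (K * (/ INR m - / INR (S m)))
      <= Cmod (u n) * exp K * (K * (/ INR m - / INR (S m))))%R
      by (apply Rmult_le_compat_r; lra).
    replace (K * (/ INR n - / INR (S m)))%R
      with (K * (/ INR n - / INR m) + K * (/ INR m - / INR (S m)))%R by ring.
    rewrite Rmult_plus_distr_l; lra.
Qed.

Lemma Gamma_seq_growth (z : C) (B : R) (n m : nat) :
  (0 < Re z)%R -> (Cmod z <= B)%R -> (1 <= n)%nat -> (n <= m)%nat ->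
  (Cmod (Gamma_seq z m) <= Cmod (Gamma_seq z n) * exp (gauss_const B))%R /\
  (Cmod (Gamma_seq z m - Gamma_seq z n)
   <= Cmod (Gamma_seq z n) * (exp (gauss_const B) * gauss_const B / INR n))%R.
Proof.
intros Hz HB Hn Hnm.
assert (HB0 : (0 <= B)%R) by (assert (H := Cmod_ge_0 z); lra).
assert (HK := gauss_const_pos B HB0); set (K := gauss_const B) in *.
destruct (telescoping_growth (Gamma_seq z) K HK
  (fun n Hn => Gamma_seq_step z B n Hz HB Hn) n m Hn Hnm) as [H1 H2].
assert (I1 : (1 <= INR n)%R) by (change 1%R with (INR 1); apply le_INR; lia).
assert (I2 : (INR n <= INR m)%R) by (apply le_INR; lia).
assert (J3 : (0 < / INR m)%R) by (apply Rinv_0_lt_compat; lra).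
assert (J4 : (/ INR n <= 1)%R) by (rewrite <- Rinv_1; apply Rinv_le_contravar; lra).
assert (Pn := Cmod_ge_0 (Gamma_seq z n)); assert (PK := exp_pos K).
split.
- apply Rle_trans with (1 := H1), Rmult_le_compat_l; [lra|].
  apply exp_monotone; nra.
- apply Rle_trans with (1 := H2); unfold Rdiv.
  rewrite !Rmult_assoc; apply Rmult_le_compat_l; [lra|].
  apply Rmult_le_compat_l; [lra|]; nra.
Qed.

Lemma Gamma_seq_1_le (z : C) : (0 < Re z)%R -> (Cmod (Gamma_seq z 1) <= / Re z)%R.
Proof.
intros Hz; assert (E : Gamma_seq z 1 = / (z * (z + 1))).
{ unfold Gamma_seq; simpl; rewrite ln_1.
  replace (z * 0) with (0 : C) by ring; rewrite Cexp_0.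
  unfold Cdiv; rewrite !Cmult_1_l, Cplus_0_r; reflexivity. }
rewrite E, Cmod_inv_total, Cmod_mult; apply Rinv_le_contravar; [exact Hz|].
assert (H1 := Re_le_Cmod z); assert (H2 := Re_le_Cmod (z + 1)).
rewrite Re_RtoC_plus in H2; nra.
Qed.

Lemma is_Clim_Gamma_pos (z : C) : (0 < Re z)%R -> is_Clim (Gamma_seq z) (Gamma z).
Proof.
intros Hz.
destruct (Clim_cauchy (Gamma_seq z)) as [l Hl].
- intros eps Heps.
  set (A := (Cmod (Gamma_seq z 1) * exp (gauss_const (Cmod z))
    * (exp (gauss_const (Cmod z)) * gauss_const (Cmod z)))%R).
  destruct (nfloor_ex (Rmax 0 (A / eps))) as [N [HN1 HN2]]; [apply Rmax_l|].
  assert (HN3 := Rmax_r 0 (A / eps)).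
  exists (S N); intros n m Hn Hm.
  assert (H1 := proj1 (Gamma_seq_growth z (Cmod z) 1 n Hz (Rle_refl _) (le_n _) ltac:(lia))).
  assert (H2 := proj2 (Gamma_seq_growth z (Cmod z) n m Hz (Rle_refl _) ltac:(lia) Hm)).
  apply Rle_trans with (1 := H2).
  assert (HI : (INR (S N) <= INR n)%R) by (apply le_INR; lia).
  rewrite S_INR in HI; assert (HNp := pos_INR N).
  assert (HK := gauss_const_pos (Cmod z) (Cmod_ge_0 z)).
  assert (PK := exp_pos (gauss_const (Cmod z))).
  apply Rle_trans with (A / INR n)%R.
  + unfold A, Rdiv; rewrite <- !Rmult_assoc.
    apply Rmult_le_compat_r; [left; apply Rinv_0_lt_compat; lra|].
    apply Rmult_le_compat_r; [lra|]; apply Rmult_le_compat_r; [lra|exact H1].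
  + apply Rle_div_l; [lra|].
    replace A with (A / eps * eps)%R by (field; lra).
    rewrite Rmult_comm; apply Rmult_le_compat_l; lra.
- now rewrite (Gamma_of_is_Clim _ _ Hl).
Qed.

Lemma is_Clim_Cmod_minus_le (u : nat -> C) (l a : C) (M : R) (N : nat) :
  is_Clim u l -> (forall n, (N <= n)%nat -> (Cmod (u n - a) <= M)%R) ->
  (Cmod (l - a) <= M)%R.
Proof.
intros Hl HM; apply le_epsilon; intros eps Heps.
destruct (Hl eps Heps) as [N1 H1].
specialize (H1 (N + N1)%nat ltac:(lia)); specialize (HM (N + N1)%nat ltac:(lia)).
apply Rle_trans with (1 := Cmod_triangle_minus _ (u (N + N1)%nat) _).
rewrite Cmod_minus_sym; lra.
Qed.

Lemma is_Clim_Cmod_le (u : nat -> C) (l : C) (M : R) (N : nat) :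
  is_Clim u l -> (forall n, (N <= n)%nat -> (Cmod (u n) <= M)%R) -> (Cmod l <= M)%R.
Proof.
intros Hl HM; replace l with (l - 0) by ring.
apply (is_Clim_Cmod_minus_le u l 0 M N Hl); intros n Hn.
replace (u n - 0) with (u n) by ring; auto.
Qed.

(** The estimate of [Gamma_seq z m - Gamma_seq z n] is uniform in [m] and so survives the limit. Its
    constant involves only [s] and [B], which gives uniform convergence on the range of [l] in
    [UA_Gamma]. *)
Lemma Gamma_seq_unif (s B : R) (z : C) (n : nat) :
  (0 < s)%R -> (s <= Re z)%R -> (Cmod z <= B)%R -> (1 <= n)%nat ->
  (Cmod (Gamma z - Gamma_seq z n)
   <= / s * exp (gauss_const B) * (exp (gauss_const B) * gauss_const B) / INR n)%R.
Proof.
intros Hs Hz HB Hn.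
assert (Hz0 : (0 < Re z)%R) by lra.
apply (is_Clim_Cmod_minus_le _ _ _ _ n (is_Clim_Gamma_pos z Hz0)); intros m Hm.
destruct (Gamma_seq_growth z B n m Hz0 HB Hn Hm) as [_ H2].
destruct (Gamma_seq_growth z B 1 n Hz0 HB (le_n _) Hn) as [H1 _].
assert (H3 := Gamma_seq_1_le z Hz0).
apply Rle_trans with (1 := H2).
replace (/ s * exp (gauss_const B) * (exp (gauss_const B) * gauss_const B) / INR n)%R
  with (/ s * exp (gauss_const B) * (exp (gauss_const B) * gauss_const B / INR n))%R
  by (unfold Rdiv; ring).
assert (HB0 : (0 <= B)%R) by (assert (H := Cmod_ge_0 z); lra).
assert (HK := gauss_const_pos B HB0).
assert (PK := exp_pos (gauss_const B)).
assert (I1 : (1 <= INR n)%R) by (change 1%R with (INR 1); apply le_INR; lia).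
assert (J3 : (0 < / INR n)%R) by (apply Rinv_0_lt_compat; lra).
apply Rmult_le_compat_r; [apply Rmult_le_pos; [apply Rmult_le_pos|]; lra|].
apply Rle_trans with (1 := H1); apply Rmult_le_compat_r; [lra|].
apply Rle_trans with (1 := H3), Rinv_le_contravar; lra.
Qed.

(** [Cmod z < INR n] makes the extra factor z + n + 1 nonzero. Other Pochhammer factors may vanish:
    both sides are then 0, so the relation also holds at -1, -2, and so on. *)
Lemma Gamma_seq_shift (z : C) (n : nat) : z <> 0 -> (1 <= n)%nat ->
  (Cmod z < INR n)%R ->
  Gamma_seq z n = Gamma_seq (z + 1) n * ((z + INR (S n)) / INR n) * / z.
Proof.
intros Hz Hn HB.
assert (Hw : z + INR (S n) <> 0).
{ intros E; assert (E2 : z = - INR (S n)).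
  { replace z with (z + INR (S n) - INR (S n)) by ring; rewrite E; ring. }
  rewrite E2, Cmod_opp, Cmod_R, Rabs_right in HB by (apply Rle_ge, pos_INR).
  rewrite S_INR in HB; lra. }
assert (HP : poch z (S n) * (z + INR (S n)) = z * poch (z + 1) (S n)).
{ rewrite <- poch_S_l; reflexivity. }
assert (HI : / poch z (S n) = / poch (z + 1) (S n) * (z + INR (S n)) * / z).
{ replace (/ poch z (S n))
    with (/ (poch z (S n) * (z + INR (S n))) * (z + INR (S n))).
  - rewrite HP, Cinv_mult_total; ring.
  - rewrite Cinv_mult_total, <- Cmult_assoc, Cinv_l by exact Hw; ring. }
unfold Gamma_seq, Cdiv; rewrite HI.
replace ((z + 1) * ln (INR n)) with (z * ln (INR n) + ln (INR n)) by ring.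
rewrite Cexp_plus, Cexp_R, exp_ln by (apply lt_0_INR; lia).
replace (INR (fact n) * Cexp (z * ln (INR n)) *
  (/ poch (z + 1) (S n) * (z + INR (S n)) * / z))
 with (INR (fact n) * Cexp (z * ln (INR n)) *
  (/ poch (z + 1) (S n) * (z + INR (S n)) * / z) * (INR n * / INR n)); [ring|].
rewrite Cinv_r by now apply INR_neq_0_C.
ring.
Qed.

Lemma is_Clim_affine_ratio (z : C) : is_Clim (fun n => (z + INR (S n)) / INR n) 1.
Proof.
apply (is_Clim_of_inv _ _ (Cmod z + 1) 1); intros n Hn _.
assert (Hn0 := INR_neq_0_C n Hn).
replace ((z + INR (S n)) / INR n - 1) with ((z + 1) / INR n)
  by (rewrite S_INR, RtoC_plus; field; auto).
rewrite Cmod_div by auto; rewrite Cmod_R, Rabs_right by (apply Rle_ge, pos_INR).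
apply Rmult_le_compat_r; [left; apply Rinv_0_lt_compat, lt_0_INR; lia|].
apply Rle_trans with (1 := Cmod_triangle _ _); rewrite Cmod_1; lra.
Qed.

Lemma Cmod_lt_INR_eventually (z : C) : exists N, (1 <= N)%nat /\
  forall n, (N <= n)%nat -> (Cmod z < INR n)%R.
Proof.
destruct (nfloor_ex (Cmod z) (Cmod_ge_0 z)) as [N [_ HN]].
exists (S N); split; [lia|]; intros n Hn.
apply le_INR in Hn; rewrite S_INR in Hn; lra.
Qed.

Lemma is_Clim_Gamma_seq_shift (z l : C) : z <> 0 ->
  is_Clim (Gamma_seq (z + 1)) l -> is_Clim (Gamma_seq z) (l * / z).
Proof.
intros Hz Hl; destruct (Cmod_lt_INR_eventually z) as [N [HN1 HN2]].
apply (is_Clim_ext_ev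
  (fun n => Gamma_seq (z + 1) n * ((z + INR (S n)) / INR n) * / z) _ _ N).
- intros n Hn; symmetry; apply Gamma_seq_shift; [exact Hz | lia | auto].
- replace (l * / z) with (l * 1 * / z) by ring.
  apply is_Clim_mult; [|apply is_Clim_const].
  apply is_Clim_mult; [exact Hl | apply is_Clim_affine_ratio].
Qed.

Lemma Gamma_seq_0 (n : nat) : Gamma_seq 0 n = 0.
Proof.
unfold Gamma_seq; rewrite poch_S_l.
unfold Cdiv; rewrite Cinv_mult_total, Cinv_zero; ring.
Qed.

Lemma Gamma_0 : Gamma 0 = 0.
Proof.
apply Gamma_of_is_Clim, (is_Clim_ext_ev (fun _ => 0) _ _ 0).
- intros n _; now rewrite Gamma_seq_0.
- apply is_Clim_const.
Qed.

(** Every point reaches the right half-plane after finitely many unit steps. This is the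
    continuation of Gamma by its functional equation, put as an induction principle. *)
Lemma Gamma_shift_ind (P : C -> Prop) :
  (forall z, (0 < Re z)%R -> P z) -> (forall z, P (z + 1) -> P z) -> forall z, P z.
Proof.
intros H0 HS z; destruct (nfloor_ex (Cmod z) (Cmod_ge_0 z)) as [N [_ HN]].
assert (H : forall k w, (0 < Re w + INR k)%R -> P w).
{ induction k as [|k IH]; intros w Hw.
  - apply H0; simpl in Hw; lra.
  - apply HS, IH; rewrite Re_RtoC_plus; rewrite S_INR in Hw; lra. }
apply (H (S N)); rewrite S_INR; assert (E := re_le_Cmod z).
assert (E2 := Rle_abs (- Re z)); rewrite Rabs_Ropp in E2; lra.
Qed.

Lemma is_Clim_Gamma (z : C) : is_Clim (Gamma_seq z) (Gamma z).
Proof.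
revert z; apply Gamma_shift_ind; [exact is_Clim_Gamma_pos|].
intros z H; destruct (Ceq_dec z 0) as [->|Hz].
- rewrite Gamma_0; apply (is_Clim_ext_ev (fun _ => 0) _ _ 0).
  + intros n _; now rewrite Gamma_seq_0.
  + apply is_Clim_const.
- assert (H1 := is_Clim_Gamma_seq_shift z _ Hz H).
  now rewrite (Gamma_of_is_Clim _ _ H1).
Qed.

Lemma Gamma_succ (z : C) : z <> 0 -> Gamma (z + 1) = z * Gamma z.
Proof.
intros Hz; rewrite (Gamma_of_is_Clim z _ (is_Clim_Gamma_seq_shift z _ Hz (is_Clim_Gamma _))).
field; exact Hz.
Qed.

(** With the value 0 at the poles, [/ Gamma] is the entire reciprocal, and its recursion holds at
    [z = 0] as well. The lowering relation owes to this its validity at the poles of omega. *)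
Lemma Gamma_inv_succ (z : C) : / Gamma z = z * / Gamma (z + 1).
Proof.
destruct (Ceq_dec z 0) as [->|Hz]; [rewrite Gamma_0, Cinv_zero; ring|].
rewrite Gamma_succ, Cinv_mult_total, Cmult_assoc, Cinv_r by exact Hz; ring.
Qed.

(** The error of the Gauss product is relative: for n > 2 K the limit differs from the nonzero
    [Gamma_seq z n] by less than its modulus. *)
Lemma Gamma_neq_0_pos (z : C) : (0 < Re z)%R -> Gamma z <> 0.
Proof.
intros Hz E.
set (K := (exp (gauss_const (Cmod z)) * gauss_const (Cmod z))%R).
assert (HK : (0 <= K)%R).
{ apply Rmult_le_pos; [left; apply exp_pos | apply gauss_const_pos, Cmod_ge_0]. }
destruct (nfloor_ex (2 * K)%R) as [N [_ HN]]; [lra|].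
assert (HN1 : (0 < INR (S N))%R) by (apply lt_0_INR; lia).
assert (HN2 : (0 < Cmod (Gamma_seq z (S N)))%R).
{ apply Cmod_gt_0; unfold Gamma_seq, Cdiv; apply Cmult_neq_0.
  - apply Cmult_neq_0; [apply INR_neq_0_C, lt_O_fact | apply Cexp_neq_0].
  - intros E2; assert (E3 := poch_neq_0 z (S (S N)) Hz).
    assert (E4 := Cinv_r _ E3); rewrite E2, Cmult_0_r in E4; injection E4; lra. }
assert (H : (Cmod (Gamma z - Gamma_seq z (S N))
   <= Cmod (Gamma_seq z (S N)) * (K / INR (S N)))%R).
{ apply (is_Clim_Cmod_minus_le _ _ _ _ (S N) (is_Clim_Gamma z)); intros m Hm.
  apply (Gamma_seq_growth z (Cmod z) (S N) m Hz (Rle_refl _)); [lia | exact Hm]. }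
rewrite E, Cmod_minus_sym in H.
replace (Gamma_seq z (S N) - 0) with (Gamma_seq z (S N)) in H by ring.
assert (K / INR (S N) < 1)%R by (apply Rlt_div_l; rewrite ?S_INR in *; lra).
nra.
Qed.

Lemma Gamma_neq_0 (z : C) : (forall k : nat, z <> - INR k) -> Gamma z <> 0.
Proof.
revert z; apply (Gamma_shift_ind (fun z => (forall k : nat, z <> - INR k) -> Gamma z <> 0)).
- intros z Hz _; now apply Gamma_neq_0_pos.
- intros z IH Hz E; apply IH.
  + intros k Hk; apply (Hz (S k)); rewrite S_INR, RtoC_plus.
    replace z with (z + 1 - 1) by ring; rewrite Hk; ring.
  + rewrite Gamma_succ, E; [ring|]; intros E0; apply (Hz O); rewrite E0; simpl; ring.
Qed.

(* A primitive of [u |-> ln (1 + t^2 / u^2)], with limit 0 at infinity. *)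
Definition lnprim (t u : R) : R := (u * ln (1 + t ^ 2 / u ^ 2) - 2 * t * atan (t / u))%R.

Lemma one_plus_sq_pos (t u : R) : (1 <= 1 + t ^ 2 / u ^ 2)%R.
Proof.
assert (0 <= t ^ 2 / u ^ 2)%R; [|lra].
unfold Rdiv; rewrite <- pow_inv, <- Rpow_mult_distr; apply pow2_ge_0.
Qed.

Lemma is_derive_lnprim (t u : R) : (0 < u)%R ->
  is_derive (lnprim t) u (ln (1 + t ^ 2 / u ^ 2)).
Proof.
intros Hu; assert (H := one_plus_sq_pos t u); unfold lnprim.
auto_derive.
- repeat split; try lra; simpl in *; try nra.
- change (ln (1 + t * (t * 1) * / (u * (u * 1)))) with (ln (1 + t ^ 2 / u ^ 2)).
  generalize (ln (1 + t ^ 2 / u ^ 2)); intros L.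
  field; repeat split; nra.
Qed.

(** The integrand decreases in [u], so its integral over a unit interval is at most its value at the
    left end. *)
Lemma lnprim_step (t u : R) : (0 < u)%R ->
  (lnprim t (u + 1) - lnprim t u <= ln (1 + t ^ 2 / u ^ 2))%R.
Proof.
intros Hu.
destruct (MVT_gen (lnprim t) u (u + 1) (fun v => ln (1 + t ^ 2 / v ^ 2))%R) as [c [Hc E]].
- intros x Hx; apply is_derive_lnprim; rewrite Rmin_left in Hx; lra.
- intros x Hx; apply continuity_pt_filterlim.
  apply (ex_derive_continuous (V := R_NormedModule) (lnprim t)).
  exists (ln (1 + t ^ 2 / x ^ 2))%R; apply is_derive_lnprim.
  rewrite Rmin_left in Hx; lra.
- rewrite Rmin_left, Rmax_right in Hc by lra; rewrite E.
  replace (u + 1 - u)%R with 1%R by ring; rewrite Rmult_1_r.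
  apply ln_le; [assert (H := one_plus_sq_pos t c); lra|].
  apply Rplus_le_compat_l, Rmult_le_compat_l; [apply pow2_ge_0|].
  apply Rinv_le_contravar; [nra|]; apply pow_incr; lra.
Qed.

(** The quotient of the two squared moduli is the product of 1 + y^2 / (s + j)^2 over j < k; its
    logarithm is compared term by term with an integral through [lnprim_step]. *)
Lemma poch_imag_lower (s y : R) (k : nat) : (0 < s)%R ->
  (Cmod (poch s k) ^ 2 * exp (lnprim (Rabs y) (s + INR k) - lnprim (Rabs y) s)
   <= Cmod (poch (s, y) k) ^ 2)%R.
Proof.
intros Hs; induction k as [|k IH].
- simpl poch; simpl INR; rewrite Rplus_0_r, Rminus_diag, exp_0; lra.
- change (poch s (S k)) with (poch s k * (s + INR k)).
  change (poch (s, y) (S k)) with (poch (s, y) k * ((s, y) + INR k)).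
  assert (Hk := pos_INR k).
  rewrite !Cmod_mult, !Rpow_mult_distr, S_INR, <- RtoC_plus, Cmod_R.
  rewrite pow2_abs, (Cmod2_alt ((s, y) + INR k)).
  replace (Re ((s, y) + INR k)) with (s + INR k)%R by reflexivity.
  replace (Im ((s, y) + INR k)) with y by (simpl; ring).
  set (v := (s + INR k)%R) in *; assert (Hv : (0 < v)%R) by (unfold v; lra).
  replace (s + (INR k + 1))%R with (v + 1)%R by (unfold v; ring).
  assert (HS := lnprim_step (Rabs y) v Hv).
  replace (lnprim (Rabs y) (v + 1) - lnprim (Rabs y) s)%R
    with ((lnprim (Rabs y) v - lnprim (Rabs y) s)
      + (lnprim (Rabs y) (v + 1) - lnprim (Rabs y) v))%R by ring.
  rewrite exp_plus.
  assert (HE : (exp (lnprim (Rabs y) (v + 1) - lnprim (Rabs y) v) <= 1 + y ^ 2 / v ^ 2)%R).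
  { rewrite <- (pow2_abs y), <- (exp_ln (1 + Rabs y ^ 2 / v ^ 2)).
    - now apply exp_monotone.
    - assert (H := one_plus_sq_pos (Rabs y) v); lra. }
  assert (E : (v ^ 2 + y ^ 2 = v ^ 2 * (1 + y ^ 2 / v ^ 2))%R) by (field; lra).
  rewrite E.
  set (P := (Cmod (poch s k) ^ 2)%R) in *; set (Q := (Cmod (poch (s, y) k) ^ 2)%R) in *.
  set (e1 := exp (lnprim (Rabs y) v - lnprim (Rabs y) s)) in *.
  set (e2 := exp (lnprim (Rabs y) (v + 1) - lnprim (Rabs y) v)) in *.
  set (w := (1 + y ^ 2 / v ^ 2)%R) in *.
  replace (P * v ^ 2 * (e1 * e2))%R with ((P * e1) * (v ^ 2 * e2))%R by ring.
  assert (0 < e1)%R by apply exp_pos; assert (0 < e2)%R by apply exp_pos.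
  assert (0 <= P)%R by apply pow2_ge_0.
  apply Rmult_le_compat; try nra.
Qed.

Lemma atan_le_id (x : R) : (0 <= x)%R -> (atan x <= x)%R.
Proof.
intros Hx.
destruct (MVT_gen atan 0 x (fun x => / (1 + x²))%R) as [c [Hc E]].
- intros y _; apply is_derive_atan.
- intros y _; apply continuity_pt_filterlim, continuous_atan.
- rewrite atan_0 in E.
  assert (/ (1 + c²) <= 1)%R; [|nra].
  rewrite <- Rinv_1; apply Rinv_le_contravar; [lra|]; assert (H := Rle_0_sqr c); lra.
Qed.

Lemma lnprim_lower (t u : R) : (0 <= t)%R -> (0 < u)%R ->
  (- (2 * t ^ 2 / u) <= lnprim t u)%R.
Proof.
intros Ht Hu; unfold lnprim.
assert (H1 : (0 <= ln (1 + t ^ 2 / u ^ 2))%R).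
{ rewrite <- ln_1; apply ln_le; [lra | apply one_plus_sq_pos]. }
assert (Hd : (0 <= t / u)%R) by (apply Rdiv_le_0_compat; lra).
assert (H2 : (atan (t / u) <= t / u)%R).
{ now apply atan_le_id. }
assert (t * atan (t / u) <= t * (t / u))%R by (apply Rmult_le_compat_l; lra).
replace (2 * t ^ 2 / u)%R with (2 * (t * (t / u)))%R by (field; lra).
assert (0 <= u * ln (1 + t ^ 2 / u ^ 2))%R by (apply Rmult_le_pos; lra).
lra.
Qed.

(** The term -PI t, hence the whole decay of Gamma, comes from atan(t / u) = PI / 2 - atan(u /
    t). *)
Lemma lnprim_upper (t u : R) : (0 <= t)%R -> (0 < u)%R ->
  (lnprim t u <= u * ln (1 + t ^ 2 / u ^ 2) + 2 * u - PI * t)%R.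
Proof.
intros Ht Hu; unfold lnprim.
destruct Ht as [Ht|<-].
- assert (E : (atan (t / u) = PI / 2 - atan (u / t))%R).
  { rewrite <- atan_inv by (apply Rdiv_lt_0_compat; lra); f_equal; field; lra. }
  assert (H2 : (atan (u / t) <= u / t)%R).
  { apply atan_le_id, Rdiv_le_0_compat; lra. }
  rewrite E.
  assert (t * atan (u / t) <= u)%R.
  { apply Rle_trans with (t * (u / t))%R; [apply Rmult_le_compat_l; lra|].
    right; field; lra. }
  lra.
- lra.
Qed.

Lemma ln_growth_linear (s0 s1 d : R) : (0 < s0)%R -> (0 < d)%R -> (0 <= s1)%R ->
  exists A : R, forall t : R, (0 <= t)%R ->
  (s1 * ln (1 + t ^ 2 / s0 ^ 2) <= d * t + A)%R.
Proof.
intros H0 Hd H1.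
(* The concave logarithm lies below a tangent: ln(x q) <= x q - 1 with x = 1 + t / s0. This [q]
   makes the resulting slope 2 s1 q / s0 equal to d s1 / (s1 + 1), which is at most d. *)
set (q := (d * s0 / (2 * (s1 + 1)))%R).
assert (Hq : (0 < q)%R) by (apply Rdiv_lt_0_compat; nra).
exists (2 * s1 * (q - 1 - ln q) + 0)%R; intros t Ht.
assert (Hts : (0 <= t / s0)%R) by (apply Rdiv_le_0_compat; lra).
assert (L1 : (ln (1 + t ^ 2 / s0 ^ 2) <= 2 * ln (1 + t / s0))%R).
{ replace (2 * ln (1 + t / s0))%R with (ln ((1 + t / s0) ^ 2))
    by (rewrite ln_pow by lra; simpl; ring).
  apply ln_le.
  - assert (H := one_plus_sq_pos t s0); lra.
  - replace (t ^ 2 / s0 ^ 2)%R with ((t / s0) ^ 2)%R by (field; lra); nra. }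
assert (L2 : (ln (1 + t / s0) + ln q <= (1 + t / s0) * q - 1)%R).
{ rewrite <- ln_mult by lra.
  assert (H : (0 < (1 + t / s0) * q)%R) by nra.
  assert (H2 := exp_ineq1_le (ln ((1 + t / s0) * q))); rewrite exp_ln in H2 by auto; lra. }
assert (L3 : (2 * s1 * (t / s0 * q) <= d * t)%R).
{ replace (2 * s1 * (t / s0 * q))%R with (d * t * (s1 / (s1 + 1)))%R
    by (unfold q; field; lra).
  assert (s1 / (s1 + 1) <= 1)%R by (apply Rle_div_l; lra).
  assert (0 <= d * t)%R by nra; nra. }
assert (s1 * ln (1 + t ^ 2 / s0 ^ 2) <= s1 * (2 * ((1 + t / s0) * q - 1 - ln q)))%R
  by (apply Rmult_le_compat_l; lra).
nra.
Qed.

Lemma Gamma_seq_imag_upper (s y : R) (n : nat) : (0 < s)%R -> (1 <= n)%nat ->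
  (Cmod (Gamma_seq (s, y) n) ^ 2
   <= Cmod (Gamma_seq s n) ^ 2 * exp (lnprim (Rabs y) s - lnprim (Rabs y) (s + INR (S n))))%R.
Proof.
intros Hs Hn.
assert (HP := poch_imag_lower s y (S n) Hs).
assert (P1 : (0 < Cmod (poch s (S n)))%R) by now apply Cmod_gt_0, poch_neq_0.
assert (P2 : (0 < Cmod (poch (s, y) (S n)))%R) by now apply Cmod_gt_0, poch_neq_0.
unfold Gamma_seq, Cdiv; rewrite !Cmod_mult, !Cmod_inv_total, !Cmod_Cexp.
replace (Re ((s, y) * ln (INR n))) with (s * ln (INR n))%R by (simpl; ring).
replace (Re (s * ln (INR n))) with (s * ln (INR n))%R by (simpl; ring).
rewrite !Rpow_mult_distr.
rewrite (Rmult_assoc (Cmod (INR (fact n)) ^ 2 * exp (s * ln (INR n)) ^ 2)).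
apply Rmult_le_compat_l.
{ apply Rmult_le_pos; apply pow2_ge_0. }
rewrite !pow_inv.
set (a := lnprim (Rabs y) s) in *; set (b := lnprim (Rabs y) (s + INR (S n))) in *.
replace (a - b)%R with (- (b - a))%R by ring; rewrite exp_Ropp, <- Rinv_mult.
apply Rinv_le_contravar; [|exact HP].
apply Rmult_lt_0_compat; [apply pow_lt, P1 | apply exp_pos].
Qed.

(** An arbitrarily small part [d] of the rate PI / 2 is given up in order to absorb the power of |Im
    z| in the true asymptotics. The weight can afford this, since |2 phi - PI| < PI strictly. *)
Lemma Gamma_decay (s0 s1 d : R) : (0 < s0)%R -> (0 < d)%R ->
  exists M : R, forall z : C, (s0 <= Re z <= s1)%R ->
  (Cmod (Gamma z) <= M * exp (- ((PI / 2 - d) * Rabs (Im z))))%R.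
Proof.
intros H0 Hd.
destruct (Rlt_le_dec s1 s0) as [Hlt|Hle].
{ exists 0%R; intros z Hz; lra. }
destruct (ln_growth_linear s0 s1 (2 * d) H0) as [A HA]; [lra|lra|].
set (K := exp (gauss_const s1)).
(* In the exponent [A] comes from the logarithm, [2 * s1] from [lnprim_upper] and 1 from the tail
   term of [lnprim]; it is halved because the comparison concerns squared moduli. *)
exists (/ s0 * K * exp ((A + 2 * s1 + 1) / 2))%R; intros [s y] Hz; simpl in Hz; simpl Im.
set (t := Rabs y); assert (Ht : (0 <= t)%R) by apply Rabs_pos.
(* Beyond 2 t^2 the value of [lnprim] at s + n + 1 is at least -1. This index depends on y, but the
   bound does not, so it passes to the limit. *)
destruct (nfloor_ex (2 * t ^ 2)%R) as [N [_ HN]]; [assert (H := pow2_ge_0 t); lra|].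
assert (PK : (0 < K)%R) by apply exp_pos.
assert (P0 : (0 < / s0)%R) by now apply Rinv_0_lt_compat.
apply (is_Clim_Cmod_le _ _ _ (S N) (is_Clim_Gamma (s, y))); intros n Hn.
assert (HnI : (INR (S N) <= INR n)%R) by (apply le_INR; lia).
rewrite S_INR in HnI.
assert (HU := Gamma_seq_imag_upper s y n ltac:(lra) ltac:(lia)); fold t in HU.
assert (HL := lnprim_lower t (s + INR (S n)) Ht).
assert (HSn : (INR (S n) = INR n + 1)%R) by apply S_INR.
assert (HpN := pos_INR N).
specialize (HL ltac:(lra)).
assert (HLu := lnprim_upper t s Ht ltac:(lra)).
assert (H1 : (2 * t ^ 2 / (s + INR (S n)) <= 1)%R) by (apply Rle_div_l; lra).
assert (H2 : (s * ln (1 + t ^ 2 / s ^ 2) <= 2 * d * t + A)%R).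
{ clear H1 HU HLu; apply Rle_trans with (2 := HA t Ht).
  assert (0 <= ln (1 + t ^ 2 / s ^ 2))%R.
  { rewrite <- ln_1; apply ln_le; [lra | apply one_plus_sq_pos]. }
  assert (E1 := one_plus_sq_pos t s).
  apply Rmult_le_compat; try lra.
  apply ln_le; [lra|].
  apply Rplus_le_compat_l, Rmult_le_compat_l; [apply pow2_ge_0|].
  apply Rinv_le_contravar; [nra|]; apply pow_incr; lra. }
assert (HG : (Cmod (Gamma_seq s n) <= / s0 * K)%R).
{ assert (Hs : (0 < Re s)%R) by (simpl; lra).
  assert (HB : (Cmod s <= s1)%R) by (rewrite Cmod_R, Rabs_right; lra).
  destruct (Gamma_seq_growth s s1 1 n Hs HB (le_n _) ltac:(lia)) as [G _].
  apply Rle_trans with (1 := G), Rmult_le_compat_r; [fold K; lra|].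
  apply Rle_trans with (1 := Gamma_seq_1_le s Hs), Rinv_le_contravar; simpl; lra. }
set (D := ((A + 2 * s1 + 1) / 2 - (PI / 2 - d) * t)%R).
rewrite Rmult_assoc, <- exp_plus.
replace ((A + 2 * s1 + 1) / 2 + - ((PI / 2 - d) * t))%R with D by (unfold D; ring).
apply Rsqr_incr_0_var; [|left; apply Rmult_lt_0_compat; [nra | apply exp_pos]].
rewrite !Rsqr_pow2; apply Rle_trans with (1 := HU).
rewrite (Rpow_mult_distr (/ s0 * K)); apply Rmult_le_compat.
- apply pow2_ge_0.
- left; apply exp_pos.
- apply pow_incr; split; [apply Cmod_ge_0 | exact HG].
- simpl; rewrite Rmult_1_r, <- exp_plus; apply exp_monotone; unfold D; simpl in *; lra.
Qed.

(** * Uniform complex differentiability *)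

(** The uniform quadratic remainder is what the slicing of a rectangle consumes, and it makes the
    derivative Lipschitz ([C11_with_derivative_Lipschitz]). The bounds on [f], on [f'] and on the
    increments make the class stable under products and exponentials. *)
Definition C11_with (D : C -> Prop) (f f' : C -> C) (K : R) : Prop :=
  forall z, D z -> (Cmod (f z) <= K)%R /\ (Cmod (f' z) <= K)%R /\
  forall w, D w -> (Cmod (f w - f z) <= K * Cmod (w - z))%R /\
    (Cmod (f w - f z - f' z * (w - z)) <= K * Cmod (w - z) ^ 2)%R.

Definition C11 (D : C -> Prop) (f : C -> C) : Prop :=
  exists f' K, (0 <= K)%R /\ C11_with D f f' K.

Lemma C11_with_weaken (D : C -> Prop) (f f' : C -> C) (K L : R) :
  (K <= L)%R -> C11_with D f f' K -> C11_with D f f' L.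
Proof.
intros H Hf z Hz; destruct (Hf z Hz) as [A [B Hw]]; split; [|split]; try lra.
intros w Dw; destruct (Hw w Dw) as [E F]; split.
- apply Rle_trans with (1 := E), Rmult_le_compat_r; [apply Cmod_ge_0 | lra].
- apply Rle_trans with (1 := F), Rmult_le_compat_r; [apply pow2_ge_0 | lra].
Qed.

Lemma C11_ext (D : C -> Prop) (f g : C -> C) :
  (forall z, D z -> f z = g z) -> C11 D f -> C11 D g.
Proof.
intros E [f' [K [HK Hf]]]; exists f', K; split; [exact HK|].
intros z Hz; destruct (Hf z Hz) as [A [B Hw]]; rewrite <- (E z Hz).
split; [exact A|split; [exact B|]]; intros w Dw; rewrite <- (E w Dw); auto.
Qed.

Lemma C11_const (D : C -> Prop) (c : C) : C11 D (fun _ => c).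
Proof.
exists (fun _ => 0), (Cmod c); split; [apply Cmod_ge_0|].
intros z _; assert (H := Cmod_ge_0 c); rewrite Cmod_0.
split; [lra|split; [lra|]]; intros w _.
replace (c - c - 0 * (w - z)) with (0 : C) by ring.
replace (c - c) with (0 : C) by ring; rewrite Cmod_0.
split; apply Rmult_le_pos; auto using Cmod_ge_0, pow2_ge_0.
Qed.

Lemma C11_id (D : C -> Prop) (B : R) :
  (forall z, D z -> (Cmod z <= B)%R) -> C11 D (fun z => z).
Proof.
intros HB; exists (fun _ => 1), (Rabs B + 1)%R.
assert (H := Rabs_pos B); assert (H2 := Rle_abs B); split; [lra|].
intros z Hz; specialize (HB z Hz); rewrite Cmod_1.
split; [lra|split; [lra|]]; intros w _.
replace (w - z - 1 * (w - z)) with (0 : C) by ring; rewrite Cmod_0.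
assert (H3 := Cmod_ge_0 (w - z)); split; [nra|].
apply Rmult_le_pos; [lra | apply pow2_ge_0].
Qed.

Lemma C11_plus (D : C -> Prop) (f g : C -> C) :
  C11 D f -> C11 D g -> C11 D (fun z => f z + g z).
Proof.
intros [f' [K [HK Hf]]] [g' [L [HL Hg]]].
exists (fun z => f' z + g' z), (K + L)%R; split; [lra|].
intros z Hz; destruct (Hf z Hz) as [A1 [A2 A]], (Hg z Hz) as [B1 [B2 B]].
split; [apply Rle_trans with (1 := Cmod_triangle _ _); lra|].
split; [apply Rle_trans with (1 := Cmod_triangle _ _); lra|].
intros w Hw; destruct (A w Hw) as [A3 A4], (B w Hw) as [B3 B4]; split.
- replace (f w + g w - (f z + g z)) with ((f w - f z) + (g w - g z)) by ring.
  apply Rle_trans with (1 := Cmod_triangle _ _); lra.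
- replace (f w + g w - (f z + g z) - (f' z + g' z) * (w - z))
    with ((f w - f z - f' z * (w - z)) + (g w - g z - g' z * (w - z))) by ring.
  apply Rle_trans with (1 := Cmod_triangle _ _); lra.
Qed.

Lemma C11_mult (D : C -> Prop) (f g : C -> C) :
  C11 D f -> C11 D g -> C11 D (fun z => f z * g z).
Proof.
intros [f' [K [HK Hf]]] [g' [L [HL Hg]]].
assert (Hf2 := C11_with_weaken D f f' K (K + L) ltac:(lra) Hf).
assert (Hg2 := C11_with_weaken D g g' L (K + L) ltac:(lra) Hg).
set (M := (K + L)%R) in *; assert (HM : (0 <= M)%R) by (unfold M; lra).
exists (fun z => f' z * g z + f z * g' z), (3 * (M * M))%R; split; [nra|].
assert (P : forall a b : C, (Cmod a <= M)%R -> (Cmod b <= M)%R -> (Cmod (a * b) <= M * M)%R).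
{ intros a b Ha Hb; rewrite Cmod_mult; apply Rmult_le_compat; auto using Cmod_ge_0. }
intros z Hz; destruct (Hf2 z Hz) as [A1 [A2 A]], (Hg2 z Hz) as [B1 [B2 B]].
split; [assert (H := P _ _ A1 B1); nra|].
split.
{ apply Rle_trans with (1 := Cmod_triangle _ _).
  assert (H := P _ _ A2 B1); assert (H2 := P _ _ A1 B2); nra. }
intros w Hw; destruct (A w Hw) as [A3 A4], (B w Hw) as [B3 B4].
destruct (Hg2 w Hw) as [C1 _].
assert (Hr := Cmod_ge_0 (w - z)); set (r := Cmod (w - z)) in *.
split.
- replace (f w * g w - f z * g z) with ((f w - f z) * g w + f z * (g w - g z)) by ring.
  apply Rle_trans with (1 := Cmod_triangle _ _); rewrite !Cmod_mult.
  assert (Cmod (f w - f z) * Cmod (g w) <= (M * r) * M)%R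
    by (apply Rmult_le_compat; auto using Cmod_ge_0).
  assert (Cmod (f z) * Cmod (g w - g z) <= M * (M * r))%R
    by (apply Rmult_le_compat; auto using Cmod_ge_0).
  assert (0 <= M * M * r)%R by (apply Rmult_le_pos; nra); lra.
- replace (f w * g w - f z * g z - (f' z * g z + f z * g' z) * (w - z))
    with ((f w - f z - f' z * (w - z)) * g w
      + ((f' z * (w - z)) * (g w - g z) + f z * (g w - g z - g' z * (w - z)))) by ring.
  apply Rle_trans with (1 := Cmod_triangle _ _).
  assert (H := Cmod_triangle ((f' z * (w - z)) * (g w - g z))
    (f z * (g w - g z - g' z * (w - z)))).
  rewrite !Cmod_mult in *; fold r in H.
  assert (Cmod (f w - f z - f' z * (w - z)) * Cmod (g w) <= (M * r ^ 2) * M)%R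
    by (apply Rmult_le_compat; auto using Cmod_ge_0).
  assert (Cmod (f' z) * r * Cmod (g w - g z) <= (M * r) * (M * r))%R.
  { apply Rmult_le_compat; auto using Cmod_ge_0; [|nra].
    apply Rmult_le_pos; auto using Cmod_ge_0. }
  assert (Cmod (f z) * Cmod (g w - g z - g' z * (w - z)) <= M * (M * r ^ 2))%R
    by (apply Rmult_le_compat; auto using Cmod_ge_0).
  lra.
Qed.

Lemma C11_inv (D : C -> Prop) (f : C -> C) (m : R) : (0 < m)%R ->
  (forall z, D z -> (m <= Cmod (f z))%R) -> C11 D f -> C11 D (fun z => / f z).
Proof.
intros Hm Hlow [f' [K [HK Hf]]]; set (r := (/ m)%R).
assert (Hr : (0 < r)%R) by now apply Rinv_0_lt_compat.
assert (N : forall z, D z -> f z <> 0)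
  by (intros z Hz; apply Cmod_gt_0; specialize (Hlow z Hz); lra).
assert (I : forall z, D z -> (Cmod (/ f z) <= r)%R).
{ intros z Hz; rewrite Cmod_inv_total; apply Rinv_le_contravar; auto. }
assert (T1 : (0 <= K * (r * r))%R) by (apply Rmult_le_pos; nra).
assert (T2 : (0 <= K * K * (r * r * r))%R)
  by (repeat apply Rmult_le_pos; lra).
exists (fun z => - (f' z * (/ f z * / f z))), (r + K * (r * r) + K * K * (r * r * r))%R.
split; [lra|].
intros z Hz; destruct (Hf z Hz) as [A1 [A2 A]]; assert (Iz := I z Hz).
assert (Pz := Cmod_ge_0 (/ f z)).
split; [lra|]; split.
{ rewrite Cmod_opp, !Cmod_mult.
  assert (Cmod (f' z) * (Cmod (/ f z) * Cmod (/ f z)) <= K * (r * r))%R; [|lra].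
  apply Rmult_le_compat; auto using Cmod_ge_0; [nra|].
  apply Rmult_le_compat; auto. }
intros w Hw; destruct (A w Hw) as [A3 A4]; assert (Iw := I w Hw).
assert (Pw := Cmod_ge_0 (/ f w)).
assert (Hd := Cmod_ge_0 (w - z)); set (d := Cmod (w - z)) in *.
assert (Nz := N z Hz); assert (Nw := N w Hw); split.
- replace (/ f w - / f z) with (- ((f w - f z) * (/ f w * / f z))) by (field; auto).
  rewrite Cmod_opp, !Cmod_mult.
  assert (Cmod (f w - f z) * (Cmod (/ f w) * Cmod (/ f z)) <= K * d * (r * r))%R.
  { apply Rmult_le_compat; auto using Cmod_ge_0; [nra|].
    apply Rmult_le_compat; auto. }
  nra.
- replace (/ f w - / f z - - (f' z * (/ f z * / f z)) * (w - z))
    with (- ((f w - f z - f' z * (w - z)) * (/ f z * / f z))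
      + (f w - f z) * (f w - f z) * (/ f z * / f z * / f w)) by (field; auto).
  apply Rle_trans with (1 := Cmod_triangle _ _); rewrite Cmod_opp, !Cmod_mult.
  assert (Cmod (f w - f z - f' z * (w - z)) * (Cmod (/ f z) * Cmod (/ f z))
    <= K * d ^ 2 * (r * r))%R.
  { apply Rmult_le_compat; auto using Cmod_ge_0; [nra|].
    apply Rmult_le_compat; auto. }
  assert (Cmod (f w - f z) * Cmod (f w - f z) * (Cmod (/ f z) * Cmod (/ f z) * Cmod (/ f w))
    <= (K * d) * (K * d) * (r * r * r))%R.
  { apply Rmult_le_compat; auto using Cmod_ge_0.
    - apply Rmult_le_pos; apply Cmod_ge_0.
    - repeat apply Rmult_le_pos; auto.
    - apply Rmult_le_compat; auto using Cmod_ge_0.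
    - repeat (apply Rmult_le_compat; auto); apply Rmult_le_pos; auto. }
  assert (0 <= r * d ^ 2)%R by (apply Rmult_le_pos; nra); lra.
Qed.

Lemma C11_Cexp (D : C -> Prop) (l : C -> C) : C11 D l -> C11 D (fun z => Cexp (l z)).
Proof.
intros [l' [K [HK Hl]]].
(* [E] bounds [Cexp (l z)]. The increment h of [l] has modulus at most [2 * K], whence [F]; [L] and
   [S] are the Lipschitz and quadratic constants of Cexp(h) - 1. *)
set (E := exp K); set (F := exp (2 * K)).
assert (HE : (1 <= E)%R) by (unfold E; rewrite <- exp_0; apply exp_monotone; lra).
assert (HF : (1 <= F)%R) by (unfold F; rewrite <- exp_0; apply exp_monotone; lra).
set (S := (4 * K ^ 2 * F + K)%R); assert (HS : (0 <= S)%R).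
{ unfold S; assert (0 <= K ^ 2 * F)%R by (apply Rmult_le_pos; nra); lra. }
set (L := (K * (1 + 8 * K * F))%R); assert (HL : (0 <= L)%R).
{ unfold L; apply Rmult_le_pos; nra. }
exists (fun z => Cexp (l z) * l' z), (E * (1 + K + L + S))%R.
split; [apply Rmult_le_pos; lra|].
intros z Hz; destruct (Hl z Hz) as [A1 [A2 A]].
assert (B1 : (Cmod (Cexp (l z)) <= E)%R).
{ rewrite Cmod_Cexp; apply exp_monotone; assert (H := Re_le_Cmod (l z)); lra. }
assert (P1 := Cmod_ge_0 (Cexp (l z))).
split; [nra|]; split.
{ rewrite Cmod_mult; apply Rmult_le_compat; auto using Cmod_ge_0; lra. }
intros w Hw; destruct (A w Hw) as [A3 A4]; destruct (Hl w Hw) as [C1 _].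
assert (Hd := Cmod_ge_0 (w - z)); set (d := Cmod (w - z)) in *.
set (h := l w - l z) in *.
assert (Hh := Cmod_ge_0 h).
assert (Hh2 : (Cmod h <= 2 * K)%R).
{ unfold h; apply Rle_trans with (1 := Cmod_triangle _ _); rewrite Cmod_opp; lra. }
assert (EW : Cexp (l w) = Cexp (l z) * Cexp h)
  by (rewrite <- Cexp_plus; f_equal; unfold h; ring).
assert (HR := Cexp_remainder_le h).
assert (HR2 : (Cmod (Cexp h - 1 - h) <= 4 * Cmod h ^ 2 * F)%R).
{ apply Rle_trans with (1 := HR), Rmult_le_compat_l; [nra|]; now apply exp_monotone. }
rewrite EW; split.
- replace (Cexp (l z) * Cexp h - Cexp (l z))
    with (Cexp (l z) * ((Cexp h - 1 - h) + h)) by ring.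
  rewrite Cmod_mult, Rmult_assoc; apply Rmult_le_compat; auto using Cmod_ge_0.
  apply Rle_trans with (1 := Cmod_triangle _ _).
  assert (4 * Cmod h ^ 2 * F <= 8 * K * F * Cmod h)%R.
  { replace (4 * Cmod h ^ 2 * F)%R with (4 * F * Cmod h * Cmod h)%R by ring.
    replace (8 * K * F * Cmod h)%R with (4 * F * Cmod h * (2 * K))%R by ring.
    apply Rmult_le_compat_l; [apply Rmult_le_pos; lra | lra]. }
  assert ((1 + 8 * K * F) * Cmod h <= (1 + 8 * K * F) * (K * d))%R
    by (apply Rmult_le_compat_l; nra).
  unfold L; assert (0 <= (1 + K + S) * d)%R by (apply Rmult_le_pos; lra); lra.
- replace (Cexp (l z) * Cexp h - Cexp (l z) - Cexp (l z) * l' z * (w - z))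
    with (Cexp (l z) * ((Cexp h - 1 - h) + (h - l' z * (w - z)))) by ring.
  rewrite Cmod_mult, Rmult_assoc; apply Rmult_le_compat; auto using Cmod_ge_0.
  apply Rle_trans with (1 := Cmod_triangle _ _).
  assert (Cmod h ^ 2 <= K ^ 2 * d ^ 2)%R.
  { rewrite <- Rpow_mult_distr; apply pow_incr; lra. }
  assert (4 * Cmod h ^ 2 * F <= 4 * K ^ 2 * F * d ^ 2)%R by nra.
  assert (0 <= d ^ 2)%R by apply pow2_ge_0.
  unfold S; assert (0 <= (1 + K + L) * d ^ 2)%R by (apply Rmult_le_pos; lra); lra.
Qed.

Lemma C11_poch (D : C -> Prop) (l : C -> C) (k : nat) :
  C11 D l -> C11 D (fun z => poch (l z) k).
Proof.
intros Hl; induction k as [|k IH]; simpl; [apply C11_const|].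
apply C11_mult; [exact IH|]; apply C11_plus; [exact Hl | apply C11_const].
Qed.

(* Uniform limits of [C11] functions: Gamma enters only as the limit of the Gauss
   sequence, without a derivative of its own. *)
Definition UA (D : C -> Prop) (f : C -> C) : Prop :=
  forall eps : R, (0 < eps)%R ->
  exists g, C11 D g /\ forall z, D z -> (Cmod (f z - g z) <= eps)%R.

Lemma UA_of_C11 (D : C -> Prop) (f : C -> C) : C11 D f -> UA D f.
Proof.
intros H eps He; exists f; split; [exact H|]; intros z _.
replace (f z - f z) with (0 : C) by ring; rewrite Cmod_0; lra.
Qed.

Lemma C11_bounded (D : C -> Prop) (f : C -> C) : C11 D f ->
  exists K, (0 <= K)%R /\ forall z, D z -> (Cmod (f z) <= K)%R.
Proof. intros [f' [K [HK Hf]]]; exists K; split; [exact HK|]; intros z Hz; apply Hf, Hz. Qed.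

Lemma UA_bounded (D : C -> Prop) (f : C -> C) : UA D f ->
  exists K, (0 <= K)%R /\ forall z, D z -> (Cmod (f z) <= K)%R.
Proof.
intros H; destruct (H 1%R Rlt_0_1) as [g [Hg E]].
destruct (C11_bounded D g Hg) as [K [HK HB]]; exists (K + 1)%R; split; [lra|].
intros z Hz; specialize (E z Hz); specialize (HB z Hz).
assert (H1 := Cmod_minus_lower (f z) (g z)); lra.
Qed.

Lemma UA_mult (D : C -> Prop) (f g : C -> C) :
  UA D f -> UA D g -> UA D (fun z => f z * g z).
Proof.
intros Hf Hg eps He.
(* In f g - f1 g1 = f (g - g1) + (f - f1) g1 the bounds needed are those of [f] and [g1]. Hence [g1]
   is chosen first, and its bound [L] fixes the tolerance for [f1]. *)
destruct (UA_bounded D f Hf) as [K [HK BK]].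
assert (HdL : (0 < eps / (2 * (K + 1)))%R) by (apply Rdiv_lt_0_compat; lra).
destruct (Hg _ HdL) as [g1 [Cg Eg]].
destruct (C11_bounded D g1 Cg) as [L [HL BL]].
assert (HdK : (0 < eps / (2 * (L + 1)))%R) by (apply Rdiv_lt_0_compat; lra).
destruct (Hf _ HdK) as [f1 [Cf Ef]].
exists (fun z => f1 z * g1 z); split; [now apply C11_mult|]; intros z Hz.
specialize (BK z Hz); specialize (BL z Hz); specialize (Eg z Hz); specialize (Ef z Hz).
replace (f z * g z - f1 z * g1 z)
  with (f z * (g z - g1 z) + (f z - f1 z) * g1 z) by ring.
apply Rle_trans with (1 := Cmod_triangle _ _); rewrite !Cmod_mult.
assert (Cmod (f z) * Cmod (g z - g1 z) <= (K + 1) * (eps / (2 * (K + 1))))%R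
  by (apply Rmult_le_compat; auto using Cmod_ge_0; lra).
assert (Cmod (f z - f1 z) * Cmod (g1 z) <= (eps / (2 * (L + 1))) * (L + 1))%R
  by (apply Rmult_le_compat; auto using Cmod_ge_0; lra).
replace eps with ((K + 1) * (eps / (2 * (K + 1))) + (eps / (2 * (L + 1))) * (L + 1))%R
  by (field; lra).
lra.
Qed.

Lemma UA_Gamma (D : C -> Prop) (l : C -> C) (s : R) : (0 < s)%R ->
  (forall z, D z -> (s <= Re (l z))%R) -> C11 D l -> UA D (fun z => Gamma (l z)).
Proof.
intros Hs Hlow Hl eps He; destruct (C11_bounded D l Hl) as [B [HB BB]].
set (K := (/ s * exp (gauss_const B) * (exp (gauss_const B) * gauss_const B))%R).
destruct (nfloor_ex (Rmax 0 (K / eps))) as [N [HN1 HN2]]; [apply Rmax_l|].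
assert (HN3 := Rmax_r 0 (K / eps)).
exists (fun z => Gamma_seq (l z) (S N)); split.
- unfold Gamma_seq, Cdiv.
  apply C11_mult; [apply C11_mult; [apply C11_const|]|].
  + apply C11_Cexp, C11_mult; [exact Hl | apply C11_const].
  (* Each Pochhammer factor has real part at least [s], so the denominator stays away from 0 on all
     of [D]. *)
  + apply (C11_inv D (fun z => poch (l z) (S (S N))) (s ^ S (S N))).
    * now apply pow_lt.
    * intros z Hz; generalize (S (S N)); intros k; induction k as [|k IH]; simpl.
      { rewrite Cmod_1; lra. }
      rewrite Cmod_mult, Rmult_comm; apply Rmult_le_compat; auto; try lra.
      { left; now apply pow_lt. }
      apply Rle_trans with (2 := Re_le_Cmod _); rewrite Re_RtoC_plus.
      assert (H := pos_INR k); specialize (Hlow z Hz); lra.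
    * now apply C11_poch.
- intros z Hz.
  apply Rle_trans with (1 := Gamma_seq_unif s B (l z) (S N) Hs (Hlow z Hz) (BB z Hz) ltac:(lia)).
  fold K; apply Rle_div_l; [apply lt_0_INR; lia|].
  replace K with (K / eps * eps)%R by (field; lra).
  rewrite Rmult_comm, S_INR; apply Rmult_le_compat_l; lra.
Qed.

(** * Integrals along horizontal lines *)

Lemma norm_C_R (z : C) : @norm R_AbsRing C_R_NormedModule z = Cmod z.
Proof.
destruct z as [x y]; unfold norm; simpl; unfold prod_norm, norm; simpl.
unfold abs; simpl; unfold Cmod; simpl fst; simpl snd.
now rewrite <- (pow2_abs x), <- (pow2_abs y).
Qed.

(** Integrals are taken in a real normed module, where [scal] has real scalars; a complex factor has
    to be treated by components. *)
Lemma is_RInt_Cmult (f : R -> C) (a b : R) (l c : C) :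
  is_RInt (V := C_R_NormedModule) f a b l ->
  is_RInt (V := C_R_NormedModule) (fun x => c * f x) a b (c * l).
Proof.
intros H.
assert (H1 := is_RInt_fct_extend_fst (U := R_NormedModule) (V := R_NormedModule) f a b l H).
assert (H2 := is_RInt_fct_extend_snd (U := R_NormedModule) (V := R_NormedModule) f a b l H).
apply (is_RInt_fct_extend_pair (U := R_NormedModule) (V := R_NormedModule)
  (fun x => c * f x) a b (fst c * fst l - snd c * snd l)%R (fst c * snd l + snd c * fst l)%R).
- exact (is_RInt_minus _ _ _ _ _ _ (is_RInt_scal _ _ _ (fst c) _ H1)
    (is_RInt_scal _ _ _ (snd c) _ H2)).
- exact (is_RInt_plus _ _ _ _ _ _ (is_RInt_scal _ _ _ (fst c) _ H2)
    (is_RInt_scal _ _ _ (snd c) _ H1)).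
Qed.

Lemma Cmod_RInt_le (f : R -> C) (a b : R) (l : C) (M : R) : (a <= b)%R ->
  (forall x, (a <= x <= b)%R -> (Cmod (f x) <= M)%R) ->
  is_RInt (V := C_R_NormedModule) f a b l -> (Cmod l <= (b - a) * M)%R.
Proof.
intros Hab HM H; rewrite <- norm_C_R.
apply (norm_RInt_le_const f a b l M Hab); [|exact H].
intros x Hx; rewrite norm_C_R; auto.
Qed.

Lemma continuous_C_intro (f : R -> C) (x : R) :
  (forall eps : R, (0 < eps)%R -> exists d : R, (0 < d)%R /\
     forall y, (Rabs (y - x) < d)%R -> (Cmod (f y - f x) < eps)%R) ->
  continuous (U := C_UniformSpace) f x.
Proof.
intros H; apply filterlim_locally; intros eps.
destruct (H eps (cond_pos eps)) as [d [Hd HH]].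
exists (mkposreal d Hd); intros y Hy.
apply C_NormedModule_mixin_compat1, HH, Hy.
Qed.

Definition rect (B y1 y2 : R) (z : C) : Prop :=
  (Rabs (Re z) <= B)%R /\ (y1 <= Im z <= y2)%R.

Lemma UA_continuous_line (f : C -> C) (B y1 y2 x y : R) :
  UA (rect B y1 y2) f -> (y1 <= y <= y2)%R -> (Rabs x < B)%R ->
  continuous (U := C_UniformSpace) (fun t => f (t, y)) x.
Proof.
intros Hf Hy Hx; apply continuous_C_intro; intros eps He.
destruct (Hf (eps / 4)%R) as [g [[g' [K [HK Hg]]] E]]; [lra|].
assert (HBx : (0 < B - Rabs x)%R) by lra.
assert (HK1 : (0 < eps / (4 * (K + 1)))%R) by (apply Rdiv_lt_0_compat; lra).
exists (Rmin (B - Rabs x) (eps / (4 * (K + 1)))); split; [now apply Rmin_glb_lt|].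
intros t Ht.
assert (Ht1 := Rlt_le_trans _ _ _ Ht (Rmin_l _ _)).
assert (Ht2 := Rlt_le_trans _ _ _ Ht (Rmin_r _ _)).
assert (Dx : rect B y1 y2 (x, y)) by (split; simpl; lra).
assert (Dt : rect B y1 y2 (t, y)).
{ split; simpl; [|lra].
  replace t with ((t - x) + x)%R by ring; assert (H := Rabs_triang (t - x) x); lra. }
assert (L := proj1 (proj2 (proj2 (Hg _ Dx)) _ Dt)).
assert (Et := E _ Dt); assert (Ex := E _ Dx); rewrite Cmod_minus_sym in Ex.
replace ((t, y) - (x, y)) with (RtoC (t - x)) in L
  by (apply injective_projections; simpl; ring).
rewrite Cmod_R in L.
assert (K * Rabs (t - x) <= eps / 4)%R.
{ apply Rle_trans with ((K + 1) * (eps / (4 * (K + 1))))%R.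
  - apply Rmult_le_compat; auto using Rabs_pos; lra.
  - right; field; lra. }
assert (H1 := Cmod_triangle_minus (f (t, y)) (g (t, y)) (f (x, y))).
assert (H2 := Cmod_triangle_minus (g (t, y)) (g (x, y)) (f (x, y))).
apply Rle_lt_trans with (1 := H1); lra.
Qed.

Lemma UA_is_RInt (f : C -> C) (B y1 y2 y a b : R) :
  UA (rect B y1 y2) f -> (y1 <= y <= y2)%R -> (Rabs a < B)%R -> (Rabs b < B)%R ->
  is_RInt (V := C_R_NormedModule) (fun t => f (t, y)) a b
    (RInt (V := C_R_CompleteNormedModule) (fun t => f (t, y)) a b).
Proof.
intros Hf Hy Ha Hb.
apply (RInt_correct (V := C_R_CompleteNormedModule)), ex_RInt_continuous.
intros x Hx; apply (UA_continuous_line f B y1 y2 x y Hf Hy).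
revert Hx Ha Hb; unfold Rmin, Rmax, Rabs.
destruct (Rle_dec a b), (Rcase_abs a), (Rcase_abs b), (Rcase_abs x); lra.
Qed.

Lemma minus_scal_C (a b c : C) (h : R) :
  @minus C_R_NormedModule (minus a b) (@scal _ C_R_NormedModule h c) = a - b - c * h.
Proof.
destruct a, b, c; apply injective_projections; simpl;
  unfold minus, plus, opp, scal; simpl; unfold mult; simpl;
  unfold plus, opp; simpl; ring.
Qed.

Lemma C11_with_is_derive_line (f f' : C -> C) (K B y1 y2 x y : R) : (0 <= K)%R ->
  C11_with (rect B y1 y2) f f' K -> (y1 <= y <= y2)%R -> (Rabs x < B)%R ->
  is_derive (V := C_R_NormedModule) (fun t => f (t, y)) x (f' (x, y)).
Proof.
intros HK Hf Hy Hx; split; [apply is_linear_scal_l|].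
intros x' Hx'.
assert (Ex := is_filter_lim_locally_unique (V := R_NormedModule) x x' Hx'); subst x'.
intros eps.
assert (HBx : (0 < B - Rabs x)%R) by lra.
assert (HK1 : (0 < eps / (K + 1))%R)
  by (apply Rdiv_lt_0_compat; [apply cond_pos | lra]).
assert (Hd : (0 < Rmin (B - Rabs x) (eps / (K + 1)))%R) by now apply Rmin_glb_lt.
exists (mkposreal _ Hd); intros t Ht.
change (Rabs (t - x) < Rmin (B - Rabs x) (eps / (K + 1)))%R in Ht.
assert (Ht1 := Rlt_le_trans _ _ _ Ht (Rmin_l _ _)).
assert (Ht2 := Rlt_le_trans _ _ _ Ht (Rmin_r _ _)).
assert (Dx : rect B y1 y2 (x, y)) by (split; simpl; lra).
assert (Dt : rect B y1 y2 (t, y)).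
{ split; simpl; [|lra].
  replace t with ((t - x) + x)%R by ring; assert (H := Rabs_triang (t - x) x); lra. }
assert (L := proj2 (proj2 (proj2 (Hf _ Dx)) _ Dt)).
replace ((t, y) - (x, y)) with (RtoC (t - x)) in L
  by (apply injective_projections; simpl; ring).
rewrite Cmod_R in L.
rewrite norm_C_R.
change (norm (minus t x)) with (Rabs (t - x)).
match goal with |- (Cmod ?u <= _)%R =>
  assert (Eu : u = f (t, y) - f (x, y) - f' (x, y) * (t - x)%R) end.
2: rewrite Eu.
2: apply Rle_trans with (1 := L).
- exact (minus_scal_C (f (t, y)) (f (x, y)) (f' (x, y)) (t - x)%R).
- simpl; rewrite Rmult_1_r, <- Rmult_assoc.
  apply Rmult_le_compat_r; [apply Rabs_pos|].
  apply Rle_trans with ((K + 1) * (eps / (K + 1)))%R.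
  + apply Rmult_le_compat; auto using Rabs_pos; lra.
  + right; field; lra.
Qed.

(** Adding the remainder estimates at (z, w) and at (w, z) cancels the values of [f] and leaves (f'
    w - f' z) (w - z). *)
Lemma C11_with_derivative_Lipschitz (D : C -> Prop) (f f' : C -> C) (K : R) (z w : C) :
  C11_with D f f' K -> D z -> D w ->
  (Cmod (f' w - f' z) <= 2 * K * Cmod (w - z))%R.
Proof.
intros Hf Hz Hw.
destruct (Ceq_dec w z) as [->|Hn].
{ replace (f' z - f' z) with (0 : C) by ring; replace (z - z) with (0 : C) by ring.
  rewrite Cmod_0; lra. }
assert (L1 := proj2 (proj2 (proj2 (Hf z Hz)) w Hw)).
assert (L2 := proj2 (proj2 (proj2 (Hf w Hw)) z Hz)).
assert (Hp : (0 < Cmod (w - z))%R).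
{ apply Cmod_gt_0; intros E; apply Hn.
  replace w with (w - z + z) by ring; rewrite E; ring. }
apply Rmult_le_reg_r with (1 := Hp); rewrite <- Cmod_mult.
replace ((f' w - f' z) * (w - z))
  with ((f w - f z - f' z * (w - z)) + (f z - f w - f' w * (z - w))) by ring.
apply Rle_trans with (1 := Cmod_triangle _ _).
rewrite (Cmod_minus_sym z w) in L2; lra.
Qed.

Lemma C11_with_is_RInt_derivative (f f' : C -> C) (K B y1 y2 y r : R) : (0 <= K)%R ->
  C11_with (rect B y1 y2) f f' K -> (y1 <= y <= y2)%R -> (0 <= r < B)%R ->
  is_RInt (V := C_R_NormedModule) (fun t => f' (t, y)) (- r) r (f (r, y) - f (- r, y)%R).
Proof.
intros HK Hf Hy Hr.
assert (Hx : forall x, (Rmin (- r) r <= x <= Rmax (- r) r)%R -> (Rabs x < B)%R).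
{ intros x; rewrite Rmin_left, Rmax_right by lra; intros H; apply Rabs_def1; lra. }
apply (is_RInt_derive (V := C_R_CompleteNormedModule)
  (fun t => f (t, y)) (fun t => f' (t, y))).
- intros x H; apply (C11_with_is_derive_line f f' K B y1 y2 x y HK Hf Hy); auto.
- intros x H; apply continuous_C_intro; intros eps He; specialize (Hx x H).
  assert (HBx : (0 < B - Rabs x)%R) by lra.
  assert (HK1 : (0 < eps / (2 * (K + 1)))%R) by (apply Rdiv_lt_0_compat; lra).
  exists (Rmin (B - Rabs x) (eps / (2 * (K + 1)))); split; [now apply Rmin_glb_lt|].
  intros t Ht.
  assert (Ht1 := Rlt_le_trans _ _ _ Ht (Rmin_l _ _)).
  assert (Ht2 := Rlt_le_trans _ _ _ Ht (Rmin_r _ _)).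
  assert (Dx : rect B y1 y2 (x, y)) by (split; simpl; lra).
  assert (Dt : rect B y1 y2 (t, y)).
  { split; simpl; [|lra].
    replace t with ((t - x) + x)%R by ring; assert (H' := Rabs_triang (t - x) x); lra. }
  apply Rle_lt_trans with (1 := C11_with_derivative_Lipschitz _ f f' K _ _ Hf Dx Dt).
  replace ((t, y) - (x, y)) with (RtoC (t - x))
    by (apply injective_projections; simpl; ring).
  rewrite Cmod_R.
  apply Rle_lt_trans with (2 * (K + 1) * Rabs (t - x))%R.
  + apply Rmult_le_compat_r; [apply Rabs_pos | lra].
  + replace eps with (2 * (K + 1) * (eps / (2 * (K + 1))))%R at 1 by (field; lra).
    apply Rmult_lt_compat_l; lra.
Qed.

Definition hInt (f : C -> C) (r y : R) : C :=
  RInt (V := C_R_CompleteNormedModule) (fun t => f (t, y)) (- r)%R r.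

Lemma UA_is_RInt_hInt (f : C -> C) (B y1 y2 y r : R) :
  UA (rect B y1 y2) f -> (y1 <= y <= y2)%R -> (0 <= r < B)%R ->
  is_RInt (V := C_R_NormedModule) (fun t => f (t, y)) (- r)%R r (hInt f r y).
Proof.
intros Hf Hy Hr; apply (UA_is_RInt f B y1 y2); auto;
  rewrite ?Rabs_Ropp, Rabs_right; lra.
Qed.

(** To first order, raising the line by h adds i h times the integral of [f'], that is, i h times
    the difference of the end values of [f]. The remaining error is quadratic in h, so cutting the
    height into n slices leaves an error of order 1 / n. *)
Lemma hInt_step (f f' : C -> C) (K B y1 y2 ya yb r M : R) : (0 <= K)%R ->
  C11_with (rect B y1 y2) f f' K -> (y1 <= ya <= y2)%R -> (y1 <= yb <= y2)%R ->
  (0 <= r < B)%R -> (Cmod (f (r, ya) - f (- r, ya)%R) <= M)%R ->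
  (Cmod (hInt f r yb - hInt f r ya)
   <= Rabs (yb - ya) * M + 2 * r * K * Rabs (yb - ya) ^ 2)%R.
Proof.
intros HK Hf Ha Hb Hr HM.
assert (UF : UA (rect B y1 y2) f) by (apply UA_of_C11; exists f', K; auto).
assert (Ia := UA_is_RInt_hInt f B y1 y2 ya r UF Ha Hr).
assert (Ib := UA_is_RInt_hInt f B y1 y2 yb r UF Hb Hr).
assert (Id := C11_with_is_RInt_derivative f f' K B y1 y2 ya r HK Hf Ha Hr).
assert (I := is_RInt_minus _ _ _ _ _ _ (is_RInt_minus _ _ _ _ _ _ Ib Ia)
  (is_RInt_Cmult _ _ _ _ (Ci * (yb - ya)%R) Id)).
assert (E : (Cmod (hInt f r yb - hInt f r ya
   - Ci * (yb - ya)%R * (f (r, ya) - f (- r, ya)%R))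
   <= (r - - r) * (K * Rabs (yb - ya) ^ 2))%R).
{ refine (Cmod_RInt_le _ _ _ _ _ _ _ I); [lra|].
  intros x Hx.
  assert (Da : rect B y1 y2 (x, ya)) by (split; simpl; [apply Rabs_le|]; lra).
  assert (Db : rect B y1 y2 (x, yb)) by (split; simpl; [apply Rabs_le|]; lra).
  assert (L := proj2 (proj2 (proj2 (Hf _ Da)) _ Db)).
  replace ((x, yb) - (x, ya)) with (Ci * (yb - ya)%R) in L
    by (apply injective_projections; simpl; ring).
  rewrite Cmod_mult, Cmod_Ci, Cmod_R, Rmult_1_l in L.
  rewrite Cmult_comm in L; exact L. }
assert (T := Cmod_triangle (hInt f r yb - hInt f r ya
   - Ci * (yb - ya)%R * (f (r, ya) - f (- r, ya)%R))
   (Ci * (yb - ya)%R * (f (r, ya) - f (- r, ya)%R))).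
match type of T with (Cmod ?u <= _)%R =>
  replace u with (hInt f r yb - hInt f r ya) in T by ring end.
rewrite !Cmod_mult, Cmod_Ci, Cmod_R, Rmult_1_l in T.
assert (Rabs (yb - ya) * Cmod (f (r, ya) - f (- r, ya)%R) <= Rabs (yb - ya) * M)%R
  by (apply Rmult_le_compat_l; auto using Rabs_pos).
lra.
Qed.

Lemma le_of_le_plus_inv (x a A : R) : (0 <= A)%R ->
  (forall n : nat, (1 <= n)%nat -> (x <= a + A / INR n)%R) -> (x <= a)%R.
Proof.
intros HA H; apply le_epsilon; intros eps He.
destruct (nfloor_ex (A / eps)%R) as [N [_ HN]];
  [apply Rdiv_le_0_compat; lra|].
specialize (H (S N) ltac:(lia)); rewrite S_INR in H.
assert (HpN := pos_INR N).
assert (A / (INR N + 1) <= eps)%R; [|lra].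
apply Rle_div_l; [lra|].
replace A with (A / eps * eps)%R by (field; lra).
rewrite Rmult_comm; apply Rmult_le_compat_l; lra.
Qed.

(* Cauchy's theorem on a rectangle, in quantitative form: only the vertical sides
   contribute.  The height is subdivided and [hInt_step] applied to each slice. *)
Lemma hInt_diff_C11 (f : C -> C) (B y1 y2 ya yb r M : R) :
  C11 (rect B y1 y2) f -> (y1 <= ya <= y2)%R -> (y1 <= yb <= y2)%R ->
  (0 <= r < B)%R ->
  (forall y, (y1 <= y <= y2)%R -> (Cmod (f (r, y) - f (- r, y)%R) <= M)%R) ->
  (Cmod (hInt f r yb - hInt f r ya) <= Rabs (yb - ya) * M)%R.
Proof.
intros [f' [K [HK Hf]]] Ha Hb Hr HM.
set (h := Rabs (yb - ya)); assert (Hh : (0 <= h)%R) by apply Rabs_pos.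
apply (le_of_le_plus_inv _ _ (2 * r * K * h ^ 2)).
{ apply Rmult_le_pos; [apply Rmult_le_pos; nra | apply pow2_ge_0]. }
intros n Hn; assert (Hn0 : (0 < INR n)%R) by (apply lt_0_INR; lia).
set (s := fun k : nat => (ya + INR k * ((yb - ya) / INR n))%R).
assert (Hs : forall k, (k <= n)%nat -> (y1 <= s k <= y2)%R).
{ intros k Hk; unfold s; apply le_INR in Hk; assert (Hk0 := pos_INR k).
  replace (INR k * ((yb - ya) / INR n))%R with (INR k / INR n * (yb - ya))%R
    by (field; lra).
  assert (0 <= INR k / INR n <= 1)%R.
  { split; [apply Rdiv_le_0_compat; lra | apply Rle_div_l; lra]. }
  nra. }
assert (Hd : forall k, Rabs (s (S k) - s k) = (h / INR n)%R).
{ intros k; unfold s, h; rewrite S_INR.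
  replace (ya + (INR k + 1) * ((yb - ya) / INR n) - (ya + INR k * ((yb - ya) / INR n)))%R
    with ((yb - ya) / INR n)%R by ring.
  unfold Rdiv; rewrite Rabs_mult, Rabs_inv, (Rabs_right (INR n)) by lra; reflexivity. }
assert (Hk : forall k, (k <= n)%nat ->
  (Cmod (hInt f r (s k) - hInt f r ya)
   <= INR k * (h / INR n * M + 2 * r * K * (h / INR n) ^ 2))%R).
{ induction k as [|k IH]; intros Hk.
  - unfold s; simpl INR; rewrite Rmult_0_l, Rplus_0_r, Rmult_0_l.
    replace (hInt f r ya - hInt f r ya) with (0 : C) by ring; rewrite Cmod_0; lra.
  - specialize (IH ltac:(lia)).
    assert (ST := hInt_step f f' K B y1 y2 (s k) (s (S k)) r M HK Hf
      (Hs k ltac:(lia)) (Hs (S k) Hk) Hr (HM _ (Hs k ltac:(lia)))).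
    rewrite Hd in ST; rewrite S_INR.
    apply Rle_trans with (1 := Cmod_triangle_minus _ (hInt f r (s k)) _); lra. }
specialize (Hk n (le_n n)).
replace (s n) with yb in Hk by (unfold s; field; lra).
apply Rle_trans with (1 := Hk); right; field; lra.
Qed.

Lemma hInt_approx (f g : C -> C) (B y1 y2 y r eps : R) :
  UA (rect B y1 y2) f -> UA (rect B y1 y2) g -> (y1 <= y <= y2)%R -> (0 <= r < B)%R ->
  (forall z, rect B y1 y2 z -> (Cmod (f z - g z) <= eps)%R) ->
  (Cmod (hInt f r y - hInt g r y) <= 2 * r * eps)%R.
Proof.
intros Hf Hg Hy Hr E.
assert (If := UA_is_RInt_hInt f B y1 y2 y r Hf Hy Hr).
assert (Ig := UA_is_RInt_hInt g B y1 y2 y r Hg Hy Hr).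
assert (I := is_RInt_minus _ _ _ _ _ _ If Ig).
replace (2 * r * eps)%R with ((r - - r) * eps)%R by ring.
refine (Cmod_RInt_le _ _ _ _ _ _ _ I); [lra|].
intros x Hx; apply E; split; simpl; [apply Rabs_le|]; lra.
Qed.

(** The bound for [C11] functions involves their values only, no derivative, and therefore passes to
    uniform limits. Cauchy's theorem thus reaches Gamma. *)
Lemma hInt_diff_UA (f : C -> C) (B y1 y2 ya yb r M : R) :
  UA (rect B y1 y2) f -> (y1 <= ya <= y2)%R -> (y1 <= yb <= y2)%R ->
  (0 <= r < B)%R ->
  (forall y, (y1 <= y <= y2)%R -> (Cmod (f (r, y) - f (- r, y)%R) <= M)%R) ->
  (Cmod (hInt f r yb - hInt f r ya) <= Rabs (yb - ya) * M)%R.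
Proof.
intros Hf Ha Hb Hr HM.
set (h := Rabs (yb - ya)); assert (Hh : (0 <= h)%R) by apply Rabs_pos.
apply le_epsilon; intros eps He.
(* Each of the two horizontal integrals, of length 2 r, changes by at most 2 r d, and the bound [M]
   on the vertical sides by 2 d. *)
set (d := (eps / (4 * r + 2 * h + 1))%R).
assert (Hd : (0 < d)%R) by (apply Rdiv_lt_0_compat; lra).
destruct (Hf d Hd) as [g [Hg E]].
assert (Ug := UA_of_C11 _ _ Hg).
assert (A1 := hInt_approx f g B y1 y2 ya r d Hf Ug Ha Hr E).
assert (A2 := hInt_approx f g B y1 y2 yb r d Hf Ug Hb Hr E).
assert (A3 : (Cmod (hInt g r yb - hInt g r ya) <= h * (M + 2 * d))%R).
{ apply (hInt_diff_C11 g B y1 y2 ya yb r (M + 2 * d) Hg Ha Hb Hr); intros y Hy.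
  assert (D1 : rect B y1 y2 (r, y)) by (split; simpl; [apply Rabs_le|]; lra).
  assert (D2 : rect B y1 y2 (- r, y)%R) by (split; simpl; [apply Rabs_le|]; lra).
  assert (E1 := E _ D1); assert (E2 := E _ D2); specialize (HM y Hy).
  rewrite Cmod_minus_sym in E1.
  replace (g (r, y) - g (- r, y)%R) with ((g (r, y) - f (r, y))
    + ((f (r, y) - f (- r, y)%R) + (f (- r, y)%R - g (- r, y)%R))) by ring.
  apply Rle_trans with (1 := Cmod_triangle _ _).
  assert (T := Cmod_triangle (f (r, y) - f (- r, y)%R) (f (- r, y)%R - g (- r, y)%R)).
  lra. }
rewrite Cmod_minus_sym in A1.
assert (T1 := Cmod_triangle_minus (hInt f r yb) (hInt g r yb) (hInt f r ya)).
assert (T2 := Cmod_triangle_minus (hInt g r yb) (hInt g r ya) (hInt f r ya)).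
assert (Ed : (d * (4 * r + 2 * h + 1) = eps)%R) by (unfold d; field; lra).
nra.
Qed.

(** * Improper integrals over horizontal lines and contour shifts *)

Definition is_line (f : R -> C) (l : C) : Prop :=
  is_RInt_gen (V := C_R_NormedModule) f (Rbar_locally m_infty) (Rbar_locally p_infty) l.

(** [C_RInt_line] is total and tells nothing about convergence; every identity between such
    integrals is derived from [is_line] and read off here. *)
Lemma is_line_unique (f : R -> C) (l : C) : is_line f l -> C_RInt_line f = l.
Proof.
intros H; unfold C_RInt_line.
apply (is_RInt_gen_unique (V := C_R_CompleteNormedModule)); exact H.
Qed.

Lemma is_line_ext (f g : R -> C) (l : C) :
  (forall x, f x = g x) -> is_line f l -> is_line g l.
Proof.
intros E H; apply (is_RInt_gen_ext f g l); [|exact H].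
apply filter_forall; intros ab x _; apply E.
Qed.

Lemma is_line_plus (f g : R -> C) (k l : C) :
  is_line f k -> is_line g l -> is_line (fun x => f x + g x) (k + l).
Proof. intros Hf Hg; exact (is_RInt_gen_plus f g k l Hf Hg). Qed.

Lemma is_line_minus (f g : R -> C) (k l : C) :
  is_line f k -> is_line g l -> is_line (fun x => f x - g x) (k - l).
Proof. intros Hf Hg; exact (is_RInt_gen_minus f g k l Hf Hg). Qed.

Lemma locally_Cmod_lt (l : C) (eps : R) : (0 < eps)%R ->
  locally (T := C_UniformSpace) l (fun z => (Cmod (z - l) < eps)%R).
Proof.
intros He; assert (He2 : (0 < eps / 2)%R) by lra.
exists (mkposreal _ He2); intros z [H1 H2].
apply Rle_lt_trans with (1 := Cmod_le_abs _).
change (Rabs (fst z - fst l) < eps / 2)%R in H1.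
change (Rabs (snd z - snd l) < eps / 2)%R in H2.
simpl; unfold Rminus in *; lra.
Qed.

Lemma is_line_Cmult (f : R -> C) (l c : C) :
  is_line f l -> is_line (fun x => c * f x) (c * l).
Proof.
intros H P [eps HP].
assert (Hp := cond_pos eps); assert (Hc := Cmod_ge_0 c).
assert (Hd : (0 < eps / (Cmod c + 1))%R) by (apply Rdiv_lt_0_compat; lra).
specialize (H _ (locally_Cmod_lt l _ Hd)).
unfold filtermapi in *; revert H; apply filter_imp.
intros [a b] [y [Hy HPy]]; exists (c * y); split; [now apply is_RInt_Cmult|].
apply HP, C_NormedModule_mixin_compat1.
change (Cmod (c * y - c * l) < eps)%R.
replace (c * y - c * l) with (c * (y - l)) by ring; rewrite Cmod_mult.
apply Rle_lt_trans with ((Cmod c) * (eps / (Cmod c + 1)))%R.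
- apply Rmult_le_compat_l; lra.
- apply Rlt_le_trans with ((Cmod c + 1) * (eps / (Cmod c + 1)))%R.
  + apply Rmult_lt_compat_r; lra.
  + right; field; lra.
Qed.

Lemma is_RInt_inv_one_plus_sq (M a b : R) :
  is_RInt (fun x => M / (1 + x ^ 2))%R a b (M * atan b - M * atan a)%R.
Proof.
apply (is_RInt_derive (fun x => M * atan x)%R).
- intros x _; assert (H := pow2_ge_0 x); auto_derive; [exact I|].
  field; simpl in *; unfold Rsqr; lra.
- intros x _; assert (H := pow2_ge_0 x).
  apply (ex_derive_continuous (V := R_NormedModule)); auto_derive; simpl in *; lra.
Qed.

Lemma Cmod_RInt_atan_le (f : R -> C) (a b M : R) (l : C) :
  (forall x, (Cmod (f x) <= M / (1 + x ^ 2))%R) ->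
  is_RInt (V := C_R_NormedModule) f a b l ->
  (Cmod l <= M * Rabs (atan b - atan a))%R.
Proof.
assert (Hw : forall a b l, (a <= b)%R ->
  (forall x, (Cmod (f x) <= M / (1 + x ^ 2))%R) ->
  is_RInt (V := C_R_NormedModule) f a b l ->
  (Cmod l <= M * Rabs (atan b - atan a))%R).
{ clear a b l; intros a b l Hab Hf HI.
  assert (Hat : (atan a <= atan b)%R).
  { destruct Hab as [H | ->]; [left; now apply atan_increasing | lra]. }
  rewrite Rabs_right by lra; rewrite Rmult_minus_distr_l, <- norm_C_R.
  apply (norm_RInt_le f (fun x => M / (1 + x ^ 2))%R a b); auto.
  - intros x _; rewrite norm_C_R; apply Hf.
  - apply is_RInt_inv_one_plus_sq. }
intros Hf HI; destruct (Rle_dec a b) as [L|L]; [now apply Hw|].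
assert (HI' := is_RInt_swap _ _ _ _ HI).
apply Hw in HI'; [|lra|exact Hf].
rewrite Rabs_minus_sym; change (opp l) with (- l) in HI'; now rewrite Cmod_opp in HI'.
Qed.

Lemma atan_tail (A x y : R) : (0 < A)%R -> (A < x)%R -> (A < y)%R ->
  (Rabs (atan x - atan y) <= / A)%R.
Proof.
intros HA Hx Hy.
assert (H1 := atan_increasing _ _ Hx); assert (H2 := atan_increasing _ _ Hy).
assert (H3 := atan_bound x); assert (H4 := atan_bound y).
assert (H5 := atan_inv A HA).
assert (H6 : (atan (/ A) <= / A)%R)
  by (apply atan_le_id; left; now apply Rinv_0_lt_compat).
apply Rabs_le; lra.
Qed.

Definition strip_UA (y1 y2 : R) (f : C -> C) : Prop := forall B, UA (rect B y1 y2) f.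

(** The majorant is chosen for its primitive [atan], whose tails are controlled by [atan_tail]; it
    also sends the vertical sides to 0. *)
Definition strip_decay (y1 y2 M : R) (f : C -> C) : Prop :=
  forall x y, (y1 <= y <= y2)%R -> (Cmod (f (x, y)) <= M / (1 + x ^ 2))%R.

Lemma strip_is_line (f : C -> C) (y1 y2 M y : R) :
  strip_UA y1 y2 f -> strip_decay y1 y2 M f -> (y1 <= y <= y2)%R ->
  exists l, is_line (fun x => f (x, y)) l.
Proof.
intros Hf HM Hy.
set (J := fun ab : R * R =>
  RInt (V := C_R_CompleteNormedModule) (fun t => f (t, y)) (fst ab) (snd ab)).
assert (HI : forall a b, is_RInt (V := C_R_NormedModule) (fun t => f (t, y)) a b (J (a, b))).
{ intros a b; assert (Pa := Rabs_pos a); assert (Pb := Rabs_pos b).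
  apply (UA_is_RInt f (Rabs a + Rabs b + 1) y1 y2 y a b (Hf _) Hy); lra. }
assert (HM0 : (0 <= M)%R).
{ assert (H := HM 0%R y Hy); assert (H2 := Cmod_ge_0 (f (0%R, y))).
  replace (M / (1 + 0 ^ 2))%R with M in H by (field; lra); lra. }
assert (HL : exists l : C_R_CompleteNormedModule,
  filterlim J (filter_prod (Rbar_locally m_infty) (Rbar_locally p_infty)) (locally l)).
{ apply (filterlim_locally_cauchy (U := C_R_CompleteNormedModule) J); intros eps.
  assert (Hp := cond_pos eps).
  (* Moving one endpoint beyond [A] changes the integral by at most [M / A]; this [A] keeps the sum
     of both changes below [eps]. *)
  set (A := (2 * (M + 1) / eps + 1)%R).
  assert (HA0 : (0 < 2 * (M + 1) / eps)%R) by (apply Rdiv_lt_0_compat; lra).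
  assert (HA : (0 < A)%R) by (unfold A; lra).
  assert (HA2 : (2 * M * / A < eps)%R).
  { apply (Rlt_div_l (2 * M)); [exact HA|]; unfold A.
    replace (eps * (2 * (M + 1) / eps + 1))%R with (2 * (M + 1) + eps)%R by (field; lra).
    lra. }
  exists (fun ab => fst ab < - A /\ A < snd ab)%R; split.
  - apply Filter_prod with (fun a => a < - A)%R (fun b => A < b)%R.
    + now exists (- A)%R.
    + now exists A.
    + intros a b H1 H2; now split.
  - intros [a b] [a' b'] [H1 H2] [H3 H4]; simpl in H1, H2, H3, H4.
    apply C_NormedModule_mixin_compat1.
    assert (E : J (a', b') = J (a', a) + (J (a, b) + J (b, b'))).
    { apply (is_RInt_unique (V := C_R_CompleteNormedModule)).
      exact (is_RInt_Chasles _ _ _ _ _ _ (HI a' a)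
        (is_RInt_Chasles _ _ _ _ _ _ (HI a b) (HI b b'))). }
    change (Cmod (J (a', b') - J (a, b)) < eps)%R.
    rewrite E; replace (J (a', a) + (J (a, b) + J (b, b')) - J (a, b))
      with (J (a', a) + J (b, b')) by ring.
    apply Rle_lt_trans with (1 := Cmod_triangle _ _).
    assert (D : forall x, (Cmod (f (x, y)) <= M / (1 + x ^ 2))%R)
      by (intros x; now apply HM).
    assert (B1 := Cmod_RInt_atan_le _ _ _ _ _ D (HI a' a)).
    assert (B2 := Cmod_RInt_atan_le _ _ _ _ _ D (HI b b')).
    assert (T1 := atan_tail A (- a) (- a') HA ltac:(lra) ltac:(lra)).
    rewrite !atan_opp in T1.
    replace (- atan a - - atan a')%R with (atan a' - atan a)%R in T1 by ring.
    rewrite Rabs_minus_sym in T1.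
    assert (T2 := atan_tail A b' b HA ltac:(lra) ltac:(lra)).
    assert (M * Rabs (atan a - atan a') <= M * / A)%R by now apply Rmult_le_compat_l.
    assert (M * Rabs (atan b' - atan b) <= M * / A)%R by now apply Rmult_le_compat_l.
    lra. }
destruct HL as [l Hl]; exists l; intros P HP.
specialize (Hl P HP); unfold filtermap in Hl; unfold filtermapi.
revert Hl; apply filter_imp; intros [a b] H; exists (J (a, b)); split; [apply HI | exact H].
Qed.

Lemma strip_hInt_lim (f : C -> C) (y1 y2 y : R) (l : C) :
  strip_UA y1 y2 f -> (y1 <= y <= y2)%R -> is_line (fun x => f (x, y)) l ->
  forall eps, (0 < eps)%R -> exists A, (0 <= A)%R /\
  forall r, (A < r)%R -> (Cmod (hInt f r y - l) < eps)%R.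
Proof.
intros Hf Hy Hl eps He.
specialize (Hl _ (locally_Cmod_lt l eps He)); unfold filtermapi in Hl.
destruct Hl as [Q1 Q2 [A1 H1] [A2 H2] HQ].
exists (Rmax 0 (Rmax (- A1) A2)); split; [apply Rmax_l|].
intros r Hr.
assert (M1 := Rmax_l 0 (Rmax (- A1) A2)); assert (M2 := Rmax_r 0 (Rmax (- A1) A2)).
assert (M3 := Rmax_l (- A1) A2); assert (M4 := Rmax_r (- A1) A2).
destruct (HQ (- r)%R r (H1 (- r)%R ltac:(lra)) (H2 r ltac:(lra))) as [z [Hz Hz2]].
assert (I := UA_is_RInt_hInt f (r + 1) y1 y2 y r (Hf _) Hy ltac:(lra)).
simpl in Hz.
assert (E := is_RInt_unique (V := C_R_CompleteNormedModule) _ _ _ _ Hz).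
unfold hInt; rewrite E; exact Hz2.
Qed.

Lemma contour_shift (f : C -> C) (y1 y2 M ya yb : R) :
  strip_UA y1 y2 f -> strip_decay y1 y2 M f ->
  (y1 <= ya <= y2)%R -> (y1 <= yb <= y2)%R ->
  exists l, is_line (fun x => f (x, ya)) l /\ is_line (fun x => f (x, yb)) l.
Proof.
intros Hf HM Ha Hb.
destruct (strip_is_line f y1 y2 M ya Hf HM Ha) as [la Hla].
destruct (strip_is_line f y1 y2 M yb Hf HM Hb) as [lb Hlb].
assert (HM0 : (0 <= M)%R).
{ assert (H := HM 0%R ya Ha); assert (H2 := Cmod_ge_0 (f (0%R, ya))).
  replace (M / (1 + 0 ^ 2))%R with M in H by (field; lra); lra. }
exists la; split; [exact Hla|].
replace la with lb; [exact Hlb|].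
assert (E : (Cmod (lb - la) <= 0)%R).
{ apply le_epsilon; intros eps He.
  destruct (strip_hInt_lim f y1 y2 ya la Hf Ha Hla (eps / 4)) as [A1 [P1 H1]]; [lra|].
  destruct (strip_hInt_lim f y1 y2 yb lb Hf Hb Hlb (eps / 4)) as [A2 [P2 H2]]; [lra|].
  set (h := Rabs (yb - ya)); assert (Hh : (0 <= h)%R) by apply Rabs_pos.
  (* Once r >= 1 + q, also 1 + r^2 >= q, and the vertical sides cost at most eps / 2; the two
     truncations take eps / 4 each. *)
  set (q := (4 * h * M / eps)%R).
  assert (Hq : (0 <= q)%R) by (apply Rdiv_le_0_compat; [nra | lra]).
  set (r := (A1 + A2 + q + 1)%R).
  specialize (H1 r ltac:(unfold r; lra)); specialize (H2 r ltac:(unfold r; lra)).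
  assert (HD : (Cmod (hInt f r yb - hInt f r ya) <= h * (2 * M / (1 + r ^ 2)))%R).
  { apply (hInt_diff_UA f (r + 1) y1 y2 ya yb r _ (Hf _) Ha Hb); [unfold r; lra|].
    intros y Hy; apply Rle_trans with (1 := Cmod_triangle _ _); rewrite Cmod_opp.
    assert (D1 := HM r y Hy); assert (D2 := HM (- r)%R y Hy).
    replace ((- r) ^ 2)%R with (r ^ 2)%R in D2 by ring.
    unfold Rdiv in *; lra. }
  assert (HR : (h * (2 * M / (1 + r ^ 2)) <= eps / 2)%R).
  { replace (h * (2 * M / (1 + r ^ 2)))%R with (2 * h * M / (1 + r ^ 2))%R
      by (field; assert (H := pow2_ge_0 r); simpl in *; lra).
    apply Rle_div_l; [assert (H := pow2_ge_0 r); lra|].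
    replace (2 * h * M)%R with (eps / 2 * q)%R by (unfold q; field; lra).
    apply Rmult_le_compat_l; [lra|].
    assert (1 + q <= r)%R by (unfold r; lra); nra. }
  rewrite Cmod_minus_sym in H2.
  assert (T1 := Cmod_triangle_minus lb (hInt f r yb) la).
  assert (T2 := Cmod_triangle_minus (hInt f r yb) (hInt f r ya) la).
  lra. }
assert (E0 : lb - la = 0) by (apply Cmod_eq_0; assert (H := Cmod_ge_0 (lb - la)); lra).
replace lb with (lb - la + la) by ring; rewrite E0; ring.
Qed.

Definition tame (y1 y2 : R) (r : C -> C) : Prop :=
  (forall B, C11 (rect B y1 y2) r) /\
  exists K m, (0 <= K)%R /\ forall x y, (y1 <= y <= y2)%R ->
    (Cmod (r (x, y)) <= K * (1 + Rabs x) ^ m)%R.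

Lemma one_plus_abs_pow (x : R) (m : nat) : (1 <= (1 + Rabs x) ^ m)%R.
Proof. apply pow_R1_Rle; assert (H := Rabs_pos x); lra. Qed.

Lemma tame_ext (y1 y2 : R) (r s : C -> C) :
  (forall z, r z = s z) -> tame y1 y2 r -> tame y1 y2 s.
Proof.
intros E [H [K [m [HK HG]]]]; split.
- intros B; apply (C11_ext _ r); auto.
- exists K, m; split; [exact HK|]; intros x y Hy; rewrite <- E; auto.
Qed.

Lemma tame_const (y1 y2 : R) (c : C) : tame y1 y2 (fun _ => c).
Proof.
split; [intros B; apply C11_const|].
exists (Cmod c), O; split; [apply Cmod_ge_0|]; intros x y _; simpl; lra.
Qed.

Lemma tame_id (y1 y2 : R) : tame y1 y2 (fun z => z).
Proof.
split.
- intros B; apply (C11_id _ (B + (Rabs y1 + Rabs y2))); intros [x y] [H1 H2].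
  apply Rle_trans with (1 := Cmod_le_abs _); simpl in *.
  apply Rplus_le_compat; [exact H1|].
  revert H2; unfold Rabs; destruct (Rcase_abs y1), (Rcase_abs y2), (Rcase_abs y); lra.
- exists (1 + (Rabs y1 + Rabs y2))%R, 1%nat.
  assert (P1 := Rabs_pos y1); assert (P2 := Rabs_pos y2); split; [lra|].
  intros x y Hy; apply Rle_trans with (1 := Cmod_le_abs _); simpl.
  assert (Rabs y <= Rabs y1 + Rabs y2)%R
    by (revert Hy; unfold Rabs; destruct (Rcase_abs y1), (Rcase_abs y2), (Rcase_abs y); lra).
  assert (P3 := Rabs_pos x); nra.
Qed.

Lemma tame_plus (y1 y2 : R) (r s : C -> C) :
  tame y1 y2 r -> tame y1 y2 s -> tame y1 y2 (fun z => r z + s z).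
Proof.
intros [H [K [m [HK HG]]]] [H' [K' [m' [HK' HG']]]]; split.
- intros B; now apply C11_plus.
- exists (K + K')%R, (m + m')%nat; split; [lra|]; intros x y Hy.
  apply Rle_trans with (1 := Cmod_triangle _ _).
  specialize (HG x y Hy); specialize (HG' x y Hy); rewrite pow_add.
  assert (P1 := one_plus_abs_pow x m); assert (P2 := one_plus_abs_pow x m').
  set (p := ((1 + Rabs x) ^ m)%R) in *; set (p' := ((1 + Rabs x) ^ m')%R) in *.
  assert (K * p <= K * (p * p'))%R by (apply Rmult_le_compat_l; nra).
  assert (K' * p' <= K' * (p * p'))%R by (apply Rmult_le_compat_l; nra).
  lra.
Qed.

Lemma tame_mult (y1 y2 : R) (r s : C -> C) :
  tame y1 y2 r -> tame y1 y2 s -> tame y1 y2 (fun z => r z * s z).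
Proof.
intros [H [K [m [HK HG]]]] [H' [K' [m' [HK' HG']]]]; split.
- intros B; now apply C11_mult.
- exists (K * K')%R, (m + m')%nat; split; [nra|]; intros x y Hy.
  rewrite Cmod_mult, pow_add.
  replace (K * K' * ((1 + Rabs x) ^ m * (1 + Rabs x) ^ m'))%R
    with (K * (1 + Rabs x) ^ m * (K' * (1 + Rabs x) ^ m'))%R by ring.
  apply Rmult_le_compat; auto using Cmod_ge_0.
Qed.

Lemma tame_inv_sub (y1 y2 : R) (w : C) : (Im w < y1 \/ y2 < Im w)%R ->
  tame y1 y2 (fun z => / (w - z)).
Proof.
intros Hw.
assert (Hm : exists m, (0 < m)%R /\ forall x y, (y1 <= y <= y2)%R -> (m <= Cmod (w - (x, y)))%R).
{ destruct Hw as [Hw|Hw]; [exists (y1 - Im w)%R | exists (Im w - y2)%R]; split; try lra;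
  intros x y Hy; apply Rle_trans with (2 := Rabs_im_le_Cmod _);
  destruct w as [u v]; simpl in *; unfold Rabs; destruct (Rcase_abs (v + - y)); lra. }
destruct Hm as [m [Hm HL]]; split.
- intros B; apply (C11_inv _ (fun z => w - z) m Hm).
  + intros [x y] [_ Hy]; apply HL, Hy.
  + apply (C11_ext _ (fun z => w + - (1) * z)); [intros z _; ring|].
    apply C11_plus; [apply C11_const|]; apply C11_mult; [apply C11_const|].
    apply (proj1 (tame_id y1 y2)).
- exists (/ m)%R, O; split; [left; now apply Rinv_0_lt_compat|].
  intros x y Hy; simpl; rewrite Rmult_1_r, Cmod_inv_total.
  apply Rinv_le_contravar; auto.
Qed.

Lemma tame_poch (y1 y2 : R) (l : C -> C) (k : nat) :
  tame y1 y2 l -> tame y1 y2 (fun z => poch (l z) k).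
Proof.
intros Hl; induction k as [|k IH]; simpl; [apply tame_const|].
apply tame_mult; [exact IH|]; apply tame_plus; [exact Hl | apply tame_const].
Qed.

Lemma sum_n_S_C (f : nat -> C) (n : nat) : (sum_n f (S n) : C) = sum_n f n + f (S n).
Proof. rewrite sum_Sn; reflexivity. Qed.

Lemma tame_sum_n (y1 y2 : R) (f : nat -> C -> C) (n : nat) :
  (forall k, tame y1 y2 (f k)) -> tame y1 y2 (fun z => sum_n (fun k => f k z) n).
Proof.
intros H; induction n as [|n IH].
- apply (tame_ext _ _ (f O)); [intros z; now rewrite sum_O | apply H].
- apply (tame_ext _ _ (fun z => sum_n (fun k => f k z) n + f (S n) z)).
  + intros z; now rewrite sum_n_S_C.
  + apply tame_plus; auto.
Qed.

Lemma tame_MP (y1 y2 lam phi : R) (n : nat) : tame y1 y2 (MP lam phi n).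
Proof.
unfold MP; apply tame_mult; [apply tame_const|].
apply tame_sum_n; intros k; unfold Cdiv.
assert (I : tame y1 y2 (fun z => Ci * z)) by (apply tame_mult; [apply tame_const | apply tame_id]).
repeat apply tame_mult; try apply tame_const; apply tame_poch.
- apply tame_plus; [apply tame_const | exact I].
- apply (tame_ext _ _ (fun z => lam + - (1) * (Ci * z))); [intros z; ring|].
  apply tame_plus; [apply tame_const|]; apply tame_mult; [apply tame_const | exact I].
Qed.

(** Omega with its two Gamma parameters made independent: a shift by i/2 lowers one of them by 1/2
    and raises the other, which leaves the family omega. *)
Definition weight (a b phi : R) (z : C) : C :=
  Cexp ((2 * phi - PI)%R * z) * Gamma (a + Ci * z) * Gamma (b - Ci * z).

Lemma C11_rect_affine (B y1 y2 : R) (a c : C) : C11 (rect B y1 y2) (fun z => a + c * z).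
Proof.
apply C11_plus; [apply C11_const|]; apply C11_mult; [apply C11_const|].
apply (proj1 (tame_id y1 y2)).
Qed.

(** At height y the two Gamma arguments have real parts [a - y] and [b + y]; the hypotheses keep
    both away from 0 on the closed strip. *)
Lemma strip_UA_weight (y1 y2 a b phi : R) : (0 < a - y2)%R -> (0 < b + y1)%R ->
  strip_UA y1 y2 (weight a b phi).
Proof.
intros Ha Hb B; unfold weight.
apply UA_mult; [apply UA_mult|].
- apply UA_of_C11, C11_Cexp, C11_mult; [apply C11_const|].
  apply (proj1 (tame_id y1 y2)).
- apply (UA_Gamma _ (fun z => a + Ci * z) (a - y2) Ha); [|apply C11_rect_affine].
  intros [x y] [_ Hy]; simpl in *; lra.
- apply (UA_Gamma _ (fun z => b - Ci * z) (b + y1) Hb).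
  + intros [x y] [_ Hy]; simpl in *; lra.
  + apply (C11_ext _ (fun z => b + (- Ci) * z)); [intros z _; ring|].
    apply C11_rect_affine.
Qed.

(** Each factor [1 + t] is paid for with half of the rate still available. *)
Lemma pow_le_exp (m : nat) (d : R) : (0 < d)%R ->
  exists M, (0 <= M)%R /\ forall t, (0 <= t)%R -> ((1 + t) ^ m <= M * exp (d * t))%R.
Proof.
revert d; induction m as [|m IH]; intros d Hd.
- exists 1%R; split; [lra|]; intros t Ht; simpl.
  assert (H : (1 <= exp (d * t))%R) by (rewrite <- exp_0; apply exp_monotone; nra); lra.
- destruct (IH (d / 2)%R ltac:(lra)) as [M [HM H]].
  assert (Hi : (0 < 2 / d)%R) by (apply Rdiv_lt_0_compat; lra).
  exists ((1 + 2 / d) * M)%R; split; [nra|]; intros t Ht; specialize (H t Ht).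
  assert (E := exp_ineq1_le (d / 2 * t)).
  replace (d * t)%R with (d / 2 * t + d / 2 * t)%R by field.
  rewrite exp_plus; simpl.
  assert (E1 : (1 + t <= (1 + 2 / d) * exp (d / 2 * t))%R).
  { apply Rle_trans with ((1 + 2 / d) * (1 + d / 2 * t))%R.
    - replace ((1 + 2 / d) * (1 + d / 2 * t))%R
        with (1 + t + (d / 2 * t + 2 / d))%R by (field; lra).
      assert (0 <= d / 2 * t)%R by nra; lra.
    - apply Rmult_le_compat_l; lra. }
  replace ((1 + 2 / d) * M * (exp (d / 2 * t) * exp (d / 2 * t)))%R
    with (((1 + 2 / d) * exp (d / 2 * t)) * (M * exp (d / 2 * t)))%R by ring.
  apply Rmult_le_compat; auto; [lra|]; apply pow_le; lra.
Qed.

Lemma weight_decay (y1 y2 a b phi : R) : (0 < phi < PI)%R ->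
  (0 < a - y2)%R -> (0 < b + y1)%R ->
  exists d M, (0 < d)%R /\ (0 <= M)%R /\ forall x y, (y1 <= y <= y2)%R ->
  (Cmod (weight a b phi (x, y)) <= M * exp (- (d * Rabs x)))%R.
Proof.
intros Hphi Ha Hb.
set (c := (2 * phi - PI)%R).
assert (Hc : (Rabs c < PI)%R) by (apply Rabs_def1; unfold c; lra).
(* The two Gamma factors give the exponent |c| - 2 (PI / 2 - d), which equals -2 d because PI - |c|
   = 4 d. *)
set (d := ((PI - Rabs c) / 4)%R); assert (Hd : (0 < d)%R) by (unfold d; lra).
destruct (Gamma_decay (a - y2) (a - y1) d Ha Hd) as [M1 H1].
destruct (Gamma_decay (b + y1) (b + y2) d Hb Hd) as [M2 H2].
exists (2 * d)%R, (Rabs M1 * Rabs M2)%R; split; [lra|].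
split; [apply Rmult_le_pos; apply Rabs_pos|]; intros x y Hy.
unfold weight; rewrite !Cmod_mult, Cmod_Cexp; fold c.
replace (Re (c * (x, y))) with (c * x)%R by (simpl; ring).
assert (G1 := H1 (a + Ci * (x, y))); assert (G2 := H2 (b - Ci * (x, y))).
replace (Re (a + Ci * (x, y))) with (a - y)%R in G1 by (simpl; ring).
replace (Im (a + Ci * (x, y))) with x in G1 by (simpl; ring).
replace (Re (b - Ci * (x, y))) with (b + y)%R in G2 by (simpl; ring).
replace (Im (b - Ci * (x, y))) with (- x)%R in G2 by (simpl; ring).
rewrite Rabs_Ropp in G2.
specialize (G1 ltac:(lra)); specialize (G2 ltac:(lra)).
set (e := exp (- ((PI / 2 - d) * Rabs x))) in *.
assert (He : (0 < e)%R) by apply exp_pos.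
assert (G1' : (Cmod (Gamma (a + Ci * (x, y))) <= Rabs M1 * e)%R)
  by (assert (H := Rle_abs M1); nra).
assert (G2' : (Cmod (Gamma (b - Ci * (x, y))) <= Rabs M2 * e)%R)
  by (assert (H := Rle_abs M2); nra).
assert (Ec : (exp (c * x) <= exp (Rabs c * Rabs x))%R)
  by (apply exp_monotone; rewrite <- Rabs_mult; apply Rle_abs).
apply Rle_trans with (exp (Rabs c * Rabs x) * (Rabs M1 * e) * (Rabs M2 * e))%R.
- apply Rmult_le_compat; auto using Cmod_ge_0.
  + apply Rmult_le_pos; [left; apply exp_pos | apply Cmod_ge_0].
  + apply Rmult_le_compat; auto using Cmod_ge_0; left; apply exp_pos.
- replace (exp (Rabs c * Rabs x) * (Rabs M1 * e) * (Rabs M2 * e))%R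
    with (Rabs M1 * Rabs M2 * (exp (Rabs c * Rabs x) * e * e))%R by ring.
  apply Rmult_le_compat_l; [apply Rmult_le_pos; apply Rabs_pos|].
  unfold e; rewrite <- !exp_plus; apply exp_monotone; unfold d.
  right; field.
Qed.

Lemma strip_decay_tame_weight (y1 y2 a b phi : R) (r : C -> C) : (0 < phi < PI)%R ->
  (0 < a - y2)%R -> (0 < b + y1)%R -> tame y1 y2 r ->
  exists M, strip_decay y1 y2 M (fun z => r z * weight a b phi z).
Proof.
intros Hphi Ha Hb [_ [K [m [HK HG]]]].
destruct (weight_decay y1 y2 a b phi Hphi Ha Hb) as [d [M [Hd [HM HW]]]].
(* The two extra powers pay for the denominator 1 + x^2 of [strip_decay]. *)
destruct (pow_le_exp (m + 2) d Hd) as [L [HL HP]].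
exists (K * L * M)%R; intros x y Hy.
specialize (HG x y Hy); specialize (HW x y Hy); specialize (HP (Rabs x) (Rabs_pos x)).
rewrite Cmod_mult.
assert (Hx : (0 < 1 + x ^ 2)%R) by (assert (H := pow2_ge_0 x); lra).
apply (proj1 (Rle_div_r _ _ _ Hx)).
assert (Hx2 : (1 + x ^ 2 <= (1 + Rabs x) ^ 2)%R).
{ rewrite <- (pow2_abs x); assert (H := Rabs_pos x); nra. }
assert (P1 := one_plus_abs_pow x m).
set (p := ((1 + Rabs x) ^ m)%R) in *; set (E := exp (d * Rabs x)) in *.
rewrite exp_Ropp in HW; fold E in HW.
assert (HE : (0 < E)%R) by apply exp_pos.
rewrite pow_add in HP; fold p in HP.
apply Rle_trans with ((K * p) * (M * / E) * (1 + Rabs x) ^ 2)%R.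
- apply Rmult_le_compat; [|lra| |exact Hx2].
  + apply Rmult_le_pos; apply Cmod_ge_0.
  + apply Rmult_le_compat; auto using Cmod_ge_0.
- replace (K * p * (M * / E) * (1 + Rabs x) ^ 2)%R
    with (K * M * / E * (p * (1 + Rabs x) ^ 2))%R by ring.
  replace (K * L * M)%R with (K * M * / E * (L * E))%R by (field; lra).
  apply Rmult_le_compat_l; [|exact HP].
  apply Rmult_le_pos; [nra|]; left; now apply Rinv_0_lt_compat.
Qed.

Lemma weight_shift (y1 y2 ya yb a b phi : R) (r : C -> C) : (0 < phi < PI)%R ->
  (0 < a - y2)%R -> (0 < b + y1)%R -> tame y1 y2 r ->
  (y1 <= ya <= y2)%R -> (y1 <= yb <= y2)%R ->
  exists l, is_line (fun x => r (x, ya) * weight a b phi (x, ya)) l /\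
            is_line (fun x => r (x, yb) * weight a b phi (x, yb)) l.
Proof.
intros Hphi Ha Hb Hr Hya Hyb.
destruct (strip_decay_tame_weight y1 y2 a b phi r Hphi Ha Hb Hr) as [M HM].
apply (contour_shift (fun z => r z * weight a b phi z) y1 y2 M); auto.
intros B; apply UA_mult; [apply UA_of_C11, Hr | now apply strip_UA_weight].
Qed.

(** * Lowering and raising relations for the polynomials *)

Lemma sum_n_S_l_C (f : nat -> C) (n : nat) :
  (sum_n f (S n) : C) = f O + sum_n (fun k => f (S k)) n.
Proof.
induction n as [|n IH].
- rewrite sum_n_S_C, !sum_O; reflexivity.
- rewrite sum_n_S_C, IH, (sum_n_S_C (fun k => f (S k))); ring.
Qed.

Lemma sum_n_ext_C (f g : nat -> C) (n : nat) :
  (forall k, (k <= n)%nat -> f k = g k) -> (sum_n f n : C) = sum_n g n.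
Proof. exact (sum_n_ext_loc f g n). Qed.

Lemma sum_n_plus_C (f g : nat -> C) (n : nat) :
  (sum_n (fun k => f k + g k) n : C) = sum_n f n + sum_n g n.
Proof. exact (sum_n_plus f g n). Qed.

Lemma sum_n_mult_C (c : C) (f : nat -> C) (n : nat) :
  (sum_n (fun k => c * f k) n : C) = c * sum_n f n.
Proof. exact (sum_n_mult_l (K := C_Ring) c f n). Qed.

Definition conv (u v : nat -> C) (n : nat) : C := sum_n (fun k => u k * v (n - k)%nat) n.

(** In terms of generating functions, the first factor is multiplied by 1 - q t, and hence so is the
    product. *)
Lemma conv_diff_l (u w v : nat -> C) (q : C) (n : nat) :
  w O = u O -> (forall k, w (S k) = u (S k) - q * u k) ->
  conv w v (S n) = conv u v (S n) - q * conv u v n.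
Proof.
intros H0 HS; unfold conv; rewrite !sum_n_S_l_C, H0.
rewrite (sum_n_ext_C (fun k => w (S k) * v (S n - S k)%nat)
  (fun k => u (S k) * v (n - k)%nat + (- q) * (u k * v (n - k)%nat))).
- rewrite sum_n_plus_C, sum_n_mult_C.
  change (fun k => u (S k) * v (S n - S k)%nat) with (fun k => u (S k) * v (n - k)%nat).
  ring.
- intros k _; rewrite HS; simpl Nat.sub; ring.
Qed.

Lemma conv_diff_r (u v w : nat -> C) (q : C) (n : nat) :
  w O = v O -> (forall k, w (S k) = v (S k) - q * v k) ->
  conv u w (S n) = conv u v (S n) - q * conv u v n.
Proof.
intros H0 HS; unfold conv; rewrite !sum_n_S_C, Nat.sub_diag, H0.
rewrite (sum_n_ext_C (fun k => u k * w (S n - k)%nat)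
  (fun k => u k * v (S n - k)%nat + (- q) * (u k * v (n - k)%nat))).
- rewrite sum_n_plus_C, sum_n_mult_C; ring.
- intros k Hk; replace (S n - k)%nat with (S (n - k)) by lia; rewrite HS; ring.
Qed.

(** The Leibniz rule for the product of two generating functions U and V with U' = q U1 and V' = p
    V1, read at the coefficient of t^n. *)
Lemma conv_weighted (u v u1 v1 : nat -> C) (q p : C) (n : nat) :
  (forall k, (INR (S k)) * u (S k) = q * u1 k) ->
  (forall k, (INR (S k)) * v (S k) = p * v1 k) ->
  INR (S n) * conv u v (S n) = q * conv u1 v n + p * conv u v1 n.
Proof.
intros Hu Hv; unfold conv.
assert (E : (sum_n (fun k => INR (S n) * (u k * v (S n - k)%nat)) (S n) : C) =
  sum_n (fun k => (INR k * u k) * v (S n - k)%nat) (S n)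
  + sum_n (fun k => u k * (INR (S n - k) * v (S n - k)%nat)) (S n)).
{ rewrite <- sum_n_plus_C; apply sum_n_ext_C; intros k Hk.
  rewrite minus_INR by lia; rewrite RtoC_minus; ring. }
rewrite <- sum_n_mult_C, E, sum_n_S_l_C; simpl (INR 0).
rewrite (sum_n_S_C (fun k => u k * (INR (S n - k) * v (S n - k)%nat))).
rewrite Nat.sub_diag; simpl (INR 0).
rewrite (sum_n_ext_C (fun k => INR (S k) * u (S k) * v (S n - S k)%nat)
  (fun k => q * (u1 k * v (n - k)%nat))).
2: { intros k _; rewrite Hu; simpl Nat.sub; ring. }
rewrite (sum_n_ext_C (fun k => u k * (INR (S n - k) * v (S n - k)%nat))
  (fun k => p * (u k * v1 (n - k)%nat))).
2: { intros k Hk; replace (S n - k)%nat with (S (n - k)) by lia; rewrite Hv; ring. }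
rewrite !sum_n_mult_C; ring.
Qed.

(** The coefficient of t^k in (1 - t)^(-a). The identities below are multiplication of this series
    by 1 - t and its differentiation. *)
Definition rising_coef (a : C) (k : nat) : C := poch a k / INR (fact k).

Lemma INR_fact_neq_0_C (k : nat) : RtoC (INR (fact k)) <> 0.
Proof. apply INR_neq_0_C, lt_O_fact. Qed.

Lemma rising_coef_S (a : C) (k : nat) :
  INR (S k) * rising_coef a (S k) = (a + INR k) * rising_coef a k.
Proof.
unfold rising_coef; change (poch a (S k)) with (poch a k * (a + INR k)).
replace (fact (S k)) with (S k * fact k)%nat by reflexivity.
rewrite mult_INR, RtoC_mult.
assert (H1 := INR_neq_0_C (S k) ltac:(lia)); assert (H2 := INR_fact_neq_0_C k).
set (x := RtoC (INR (S k))) in *; field; auto.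
Qed.

Lemma rising_coef_S_l (a : C) (k : nat) :
  INR (S k) * rising_coef a (S k) = a * rising_coef (a + 1) k.
Proof.
unfold rising_coef; rewrite poch_S_l.
replace (fact (S k)) with (S k * fact k)%nat by reflexivity.
rewrite mult_INR, RtoC_mult.
assert (H1 := INR_neq_0_C (S k) ltac:(lia)); assert (H2 := INR_fact_neq_0_C k).
set (x := RtoC (INR (S k))) in *; field; auto.
Qed.

Lemma rising_coef_pred (a : C) (k : nat) :
  rising_coef (a - 1) (S k) = rising_coef a (S k) - rising_coef a k.
Proof.
assert (H1 := INR_neq_0_C (S k) ltac:(lia)).
assert (E1 := rising_coef_S a k); assert (E2 := rising_coef_S_l (a - 1) k).
replace (a - 1 + 1) with a in E2 by ring.
set (x := RtoC (INR (S k))) in *.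
assert (Ek : RtoC (INR k) = x - 1) by (unfold x; rewrite S_INR, RtoC_plus; ring).
rewrite Ek in E1.
replace (rising_coef (a - 1) (S k)) with (/ x * (x * rising_coef (a - 1) (S k)))
  by (field; auto).
replace (rising_coef a (S k)) with (/ x * (x * rising_coef a (S k))) by (field; auto).
rewrite E1, E2; field; auto.
Qed.

Definition phase (phi : R) (k : nat) : C := Cexp (- (Ci * (2 * INR k * phi)%R)).

Lemma phase_S (phi : R) (k : nat) : phase phi (S k) = phase phi 1 * phase phi k.
Proof.
unfold phase; rewrite <- Cexp_plus, S_INR; f_equal; simpl INR.
rewrite !RtoC_mult, RtoC_plus; ring.
Qed.

(* [MP] as a function of the two independent parameters [a = lam + i x] and
   [b = lam - i x]. *)
Definition MP2 (phi : R) (n : nat) (a b : C) : C :=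
  Cexp (Ci * (INR n * phi)%R) *
  conv (fun k => rising_coef a k * phase phi k) (rising_coef b) n.

Lemma MP_MP2 (lam phi : R) (n : nat) (z : C) :
  MP lam phi n z = MP2 phi n (lam + Ci * z) (lam - Ci * z).
Proof.
unfold MP, MP2, conv; f_equal; apply sum_n_ext_C; intros k _.
unfold rising_coef, phase.
assert (H1 := INR_fact_neq_0_C k); assert (H2 := INR_fact_neq_0_C (n - k)).
field; auto.
Qed.

Lemma Cexp_S_phi (phi : R) (n : nat) :
  Cexp (Ci * (INR (S n) * phi)%R) = Cexp (Ci * phi) * Cexp (Ci * (INR n * phi)%R).
Proof.
rewrite <- Cexp_plus, S_INR; f_equal; rewrite !RtoC_mult, RtoC_plus; ring.
Qed.

Lemma phase_1 (phi : R) : phase phi 1 = Cexp (- (Ci * phi)) * Cexp (- (Ci * phi)).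
Proof.
unfold phase; rewrite <- Cexp_plus; f_equal; simpl INR.
rewrite !RtoC_mult; ring.
Qed.

Lemma Cexp_mul_opp (z : C) : Cexp z * Cexp (- z) = 1.
Proof. rewrite Cexp_opp; apply Cinv_r, Cexp_neq_0. Qed.

Lemma Ci_sq : Ci * Ci = - (1).
Proof. apply injective_projections; simpl; ring. Qed.

Lemma Cexp_sub_opp (phi : R) :
  Cexp (Ci * phi) - Cexp (- (Ci * phi)) = Ci * (2 * sin phi)%R.
Proof.
unfold Cexp; apply injective_projections; simpl.
- replace (0 * phi - 1 * 0)%R with 0%R by ring.
  replace (- 0)%R with 0%R by ring.
  replace (0 * 0 + 1 * phi)%R with phi by ring; rewrite cos_neg; ring.
- replace (0 * phi - 1 * 0)%R with 0%R by ring.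
  replace (- 0)%R with 0%R by ring.
  replace (0 * 0 + 1 * phi)%R with phi by ring; rewrite sin_neg, exp_0; ring.
Qed.

(** Lowering [a] multiplies the generating function by 1 - exp(-2 i phi) t, lowering [b] by 1 - t.
    In the difference the terms of degree n + 1 cancel; the factor 1 - exp(-2 i phi) that remains
    becomes 2 i sin phi after multiplication by exp(i phi). *)
Lemma MP2_lowering (phi : R) (n : nat) (a b : C) :
  MP2 phi (S n) (a - 1) b - MP2 phi (S n) a (b - 1)
  = Ci * (2 * sin phi)%R * MP2 phi n a b.
Proof.
unfold MP2.
rewrite (conv_diff_l (fun k => rising_coef a k * phase phi k) _ _ (phase phi 1)).
2: reflexivity.
2: { intros k; cbv beta; rewrite rising_coef_pred, phase_S; ring. }
rewrite (conv_diff_r _ (rising_coef b) (rising_coef (b - 1)) 1).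
2: reflexivity.
2: { intros k; cbv beta; rewrite rising_coef_pred; ring. }
rewrite Cexp_S_phi, <- Cexp_sub_opp, phase_1.
set (S1 := conv _ _ (S n)); set (S0 := conv _ _ n).
set (e := Cexp (Ci * (INR n * phi)%R)).
assert (H := Cexp_mul_opp (Ci * phi)).
set (p := Cexp (Ci * phi)) in *; set (m := Cexp (- (Ci * phi))) in *.
transitivity (e * S0 * (p - (p * m) * m)); [ring | rewrite H; ring].
Qed.

(** This is [conv_weighted] for (1 - exp(-2 i phi) t)^(-a) (1 - t)^(-b): differentiation raises [a]
    in one term and [b] in the other. *)
Lemma MP2_raising (phi : R) (n : nat) (a b : C) :
  Cexp (Ci * phi) * b * MP2 phi n a (b + 1) + Cexp (- (Ci * phi)) * a * MP2 phi n (a + 1) b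
  = INR (S n) * MP2 phi (S n) a b.
Proof.
unfold MP2.
set (c := conv _ _ (S n)).
replace (INR (S n) * (Cexp (Ci * (INR (S n) * phi)%R) * c))
  with (Cexp (Ci * (INR (S n) * phi)%R) * (INR (S n) * c)) by ring.
unfold c; rewrite (conv_weighted _ _
  (fun k => rising_coef (a + 1) k * phase phi k) (rising_coef (b + 1))
  (a * phase phi 1) b).
2: { intros k; cbv beta; rewrite phase_S.
  transitivity (INR (S k) * rising_coef a (S k) * (phase phi 1 * phase phi k)); [ring|].
  rewrite rising_coef_S_l; ring. }
2: { intros k; apply rising_coef_S_l. }
rewrite Cexp_S_phi, phase_1.
set (A := conv _ _ n); set (B := conv _ _ n).
set (e := Cexp (Ci * (INR n * phi)%R)).
assert (H := Cexp_mul_opp (Ci * phi)).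
set (p := Cexp (Ci * phi)) in *; set (m := Cexp (- (Ci * phi))) in *.
transitivity (e * b * p * A + e * a * (m * 1) * B); [ring|].
rewrite <- H; ring.
Qed.

(** * The weight under the shifts by [i/2] *)

Lemma half_Ci : Ci / 2 = (0, 1 / 2)%R.
Proof.
unfold Cdiv; rewrite <- RtoC_inv by lra.
apply injective_projections; simpl; field.
Qed.

Lemma one_half_half : (1 : C) = (1 / 2)%R + (1 / 2)%R.
Proof. rewrite <- RtoC_plus; f_equal; field. Qed.

Lemma Ci_half_mul (z : C) : Ci * (z + Ci / 2) = Ci * z - (1 / 2)%R.
Proof.
rewrite half_Ci; destruct z; apply injective_projections; simpl; field.
Qed.

Lemma Ci_half_mul_minus (z : C) : Ci * (z - Ci / 2) = Ci * z + (1 / 2)%R.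
Proof.
rewrite half_Ci; destruct z; apply injective_projections; simpl; field.
Qed.

Lemma Cexp_half_pi (phi : R) :
  Cexp ((2 * phi - PI)%R * (Ci / 2)) = - Ci * Cexp (Ci * phi).
Proof.
rewrite half_Ci.
replace ((2 * phi - PI)%R * (0, 1 / 2)%R) with (Ci * phi + (0, - (PI / 2))%R)
  by (apply injective_projections; simpl; field).
rewrite Cexp_plus.
replace (Cexp (0, - (PI / 2))%R) with (- Ci); [ring|].
unfold Cexp; simpl; rewrite cos_neg, sin_neg, cos_PI2, sin_PI2, exp_0.
apply injective_projections; simpl; ring.
Qed.

Lemma Cexp_half_pi_opp (phi : R) :
  Cexp (- ((2 * phi - PI)%R * (Ci / 2))) = Ci * Cexp (- (Ci * phi)).
Proof.
rewrite !Cexp_opp, Cexp_half_pi, Cinv_mult_total.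
replace (/ - Ci) with Ci; [reflexivity|].
apply injective_projections; simpl; field.
Qed.

Lemma weight_plus_half (a b phi : R) (z : C) :
  weight a b phi (z + Ci / 2) =
  - Ci * Cexp (Ci * phi) * weight (a - 1 / 2) (b + 1 / 2) phi z.
Proof.
unfold weight; rewrite Ci_half_mul, Cmult_plus_distr_l, Cexp_plus, Cexp_half_pi.
replace (a + (Ci * z - (1 / 2)%R)) with ((a - 1 / 2)%R + Ci * z)
  by (rewrite RtoC_minus; ring).
replace (b - (Ci * z - (1 / 2)%R)) with ((b + 1 / 2)%R - Ci * z)
  by (rewrite RtoC_plus; ring).
ring.
Qed.

Lemma weight_minus_half (a b phi : R) (z : C) :
  weight a b phi (z - Ci / 2) =
  Ci * Cexp (- (Ci * phi)) * weight (a + 1 / 2) (b - 1 / 2) phi z.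
Proof.
unfold weight; rewrite Ci_half_mul_minus.
replace ((2 * phi - PI)%R * (z - Ci / 2))
  with ((2 * phi - PI)%R * z + - ((2 * phi - PI)%R * (Ci / 2))) by ring.
rewrite Cexp_plus, Cexp_half_pi_opp.
replace (a + (Ci * z + (1 / 2)%R)) with ((a + 1 / 2)%R + Ci * z)
  by (rewrite RtoC_plus; ring).
replace (b - (Ci * z + (1 / 2)%R)) with ((b - 1 / 2)%R - Ci * z)
  by (rewrite RtoC_minus; ring).
ring.
Qed.

Lemma weight_succ_l (a b phi : R) (z : C) : a + Ci * z <> 0 ->
  weight (a + 1) b phi z = (a + Ci * z) * weight a b phi z.
Proof.
intros H; unfold weight.
replace ((a + 1)%R + Ci * z) with (a + Ci * z + 1) by (rewrite RtoC_plus; ring).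
rewrite Gamma_succ by exact H; ring.
Qed.

Lemma weight_succ_r (a b phi : R) (z : C) : b - Ci * z <> 0 ->
  weight a (b + 1) phi z = (b - Ci * z) * weight a b phi z.
Proof.
intros H; unfold weight.
replace ((b + 1)%R - Ci * z) with (b - Ci * z + 1) by (rewrite RtoC_plus; ring).
rewrite Gamma_succ by exact H; ring.
Qed.

Lemma weight_inv_succ_l (a b phi : R) (z : C) :
  / weight a b phi z = (a + Ci * z) * / weight (a + 1) b phi z.
Proof.
unfold weight; rewrite !Cinv_mult_total, (Gamma_inv_succ (a + Ci * z)).
replace ((a + 1)%R + Ci * z) with (a + Ci * z + 1) by (rewrite RtoC_plus; ring).
ring.
Qed.

Lemma weight_inv_succ_r (a b phi : R) (z : C) :
  / weight a b phi z = (b - Ci * z) * / weight a (b + 1) phi z.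
Proof.
unfold weight; rewrite !Cinv_mult_total, (Gamma_inv_succ (b - Ci * z)).
replace ((b + 1)%R - Ci * z) with (b - Ci * z + 1) by (rewrite RtoC_plus; ring).
ring.
Qed.

Lemma omega_weight (lam phi : R) (z : C) : omega lam phi z = weight lam lam phi z.
Proof. reflexivity. Qed.

Lemma real_param_neq_0 (a x : R) : (0 < a)%R -> a + Ci * x <> 0 /\ a - Ci * x <> 0.
Proof.
intros Ha; split; apply Cneq_0_Re; simpl; lra.
Qed.

Lemma RtoC_plus_half_Ci (x : R) : (x, 1 / 2)%R = x + Ci / 2.
Proof. rewrite half_Ci; apply injective_projections; simpl; ring. Qed.

Lemma RtoC_minus_half_Ci (x : R) : (x, - (1 / 2))%R = x - Ci / 2.
Proof. rewrite half_Ci; apply injective_projections; simpl; ring. Qed.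

(** With a and b the parameters at lam - 1/2, both shifted weights are multiples of omega(x; lam -
    1/2): by b after the shift up, by a after the shift down. The polynomials then sit at (a, b + 1)
    and (a + 1, b), the arguments of [MP2_raising]. *)
Lemma MP_weight_raising (lam phi : R) (n : nat) (x : R) : (1 / 2 < lam)%R ->
  MP lam phi n (x + Ci / 2) * weight lam lam phi (x + Ci / 2)
  - MP lam phi n (x - Ci / 2) * weight lam lam phi (x - Ci / 2)
  = - Ci * INR (S n) * (MP (lam - 1 / 2) phi (S n) x * omega (lam - 1 / 2) phi x).
Proof.
intros Hl; rewrite weight_plus_half, weight_minus_half.
rewrite !MP_MP2, Ci_half_mul, Ci_half_mul_minus, omega_weight.
destruct (real_param_neq_0 (lam - 1 / 2) x ltac:(lra)) as [Ha Hb].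
replace (lam + 1 / 2)%R with (lam - 1 / 2 + 1)%R by field.
rewrite weight_succ_l, weight_succ_r by assumption.
set (w := weight _ _ _ _).
replace (lam + (Ci * x - (1 / 2)%R)) with ((lam - 1 / 2)%R + Ci * x)
  by (rewrite RtoC_minus; ring).
replace (lam - (Ci * x + (1 / 2)%R)) with ((lam - 1 / 2)%R - Ci * x)
  by (rewrite RtoC_minus; ring).
replace (lam - (Ci * x - (1 / 2)%R)) with ((lam - 1 / 2)%R - Ci * x + 1).
2: { rewrite RtoC_minus, one_half_half; ring. }
replace (lam + (Ci * x + (1 / 2)%R)) with ((lam - 1 / 2)%R + Ci * x + 1).
2: { rewrite RtoC_minus, one_half_half; ring. }
set (a := (lam - 1 / 2)%R + Ci * x); set (b := (lam - 1 / 2)%R - Ci * x).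
assert (H := MP2_raising phi n a b).
transitivity (- Ci * w * (Cexp (Ci * phi) * b * MP2 phi n a (b + 1)
  + Cexp (- (Ci * phi)) * a * MP2 phi n (a + 1) b)); [ring | rewrite H; ring].
Qed.

Lemma MP_lowering (lam phi : R) (n : nat) (z : C) :
  MP lam phi (S n) (z + Ci / 2) - MP lam phi (S n) (z - Ci / 2)
  = Ci * (2 * sin phi)%R * MP (lam + 1 / 2) phi n z.
Proof.
rewrite !MP_MP2, Ci_half_mul, Ci_half_mul_minus, <- MP2_lowering.
replace (lam + (Ci * z - (1 / 2)%R)) with ((lam + 1 / 2)%R + Ci * z - 1)
  by (rewrite RtoC_plus, one_half_half; ring).
replace (lam - (Ci * z + (1 / 2)%R)) with ((lam + 1 / 2)%R - Ci * z - 1)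
  by (rewrite RtoC_plus, one_half_half; ring).
replace (lam - (Ci * z - (1 / 2)%R)) with ((lam + 1 / 2)%R - Ci * z)
  by (rewrite RtoC_plus; ring).
replace (lam + (Ci * z + (1 / 2)%R)) with ((lam + 1 / 2)%R + Ci * z)
  by (rewrite RtoC_plus; ring).
reflexivity.
Qed.

(** * The functions of the second kind *)

Lemma tame_MP_cauchy (y1 y2 lam phi : R) (n : nat) (w : C) :
  (Im w < y1 \/ y2 < Im w)%R -> tame y1 y2 (fun z => MP lam phi n z * / (w - z)).
Proof.
intros Hw; apply tame_mult; [apply tame_MP | now apply tame_inv_sub].
Qed.

(** The Cauchy kernel has its only pole at [w], outside the strip. With [y1 = y2 = 0] the lemma
    records that the defining integral converges. *)
Lemma omegaQ_shift (y1 y2 y lam phi : R) (n : nat) (w : C) :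
  (0 < phi < PI)%R -> (0 < lam - y2)%R -> (0 < lam + y1)%R ->
  (y1 <= 0 <= y2)%R -> (y1 <= y <= y2)%R -> (Im w < y1 \/ y2 < Im w)%R ->
  is_line (fun x => MP lam phi n (x, y) * / (w - (x, y)) * weight lam lam phi (x, y))
    (omegaQ lam phi n w).
Proof.
intros Hphi Ha Hb H0 Hy Hw.
destruct (weight_shift y1 y2 0 y lam lam phi _ Hphi Ha Hb
  (tame_MP_cauchy y1 y2 lam phi n w Hw) H0 Hy) as [l [H1 H2]].
replace (omegaQ lam phi n w) with l; [exact H2|].
symmetry; apply is_line_unique; exact H1.
Qed.

Lemma omegaQ_raising (lam phi : R) (n : nat) (z : C) :
  (0 < phi < PI)%R -> (1 / 2 < lam)%R -> (1 / 2 < Rabs (Im z))%R ->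
  T (omegaQ lam phi n) z = - (INR n + 1) * omegaQ (lam - 1 / 2) phi (n + 1) z.
Proof.
intros Hphi Hl Hz.
assert (Hz' : (Im z < - (1 / 2) \/ 1 / 2 < Im z)%R)
  by (revert Hz; unfold Rabs; destruct (Rcase_abs (Im z)); lra).
assert (Ip : Im (z + Ci / 2) = (Im z + 1 / 2)%R) by (rewrite half_Ci; destruct z; reflexivity).
assert (Im' : Im (z - Ci / 2) = (Im z - 1 / 2)%R) by (rewrite half_Ci; destruct z; reflexivity).
(* The pole z + i/2 has imaginary part above 1 or below 0, hence it avoids the strip between 0 and
   1/2; z - i/2 avoids the reflected strip in the same way. *)
assert (Lp := omegaQ_shift 0 (1 / 2) (1 / 2) lam phi n (z + Ci / 2) Hphi
  ltac:(lra) ltac:(lra) ltac:(lra) ltac:(lra) ltac:(lra)).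
assert (Lm := omegaQ_shift (- (1 / 2)) 0 (- (1 / 2)) lam phi n (z - Ci / 2) Hphi
  ltac:(lra) ltac:(lra) ltac:(lra) ltac:(lra) ltac:(lra)).
assert (LD := is_line_minus _ _ _ _ Lp Lm).
set (N := RtoC (INR (S n))).
assert (HN : N <> 0) by (apply INR_neq_0_C; lia).
assert (HCi : Ci <> 0) by (intros E; injection E; lra).
assert (HE : omegaQ (lam - 1 / 2) phi (n + 1) z =
  / (- Ci * N) * (omegaQ lam phi n (z + Ci / 2) - omegaQ lam phi n (z - Ci / 2))).
{ apply is_line_unique.
  eapply is_line_ext; [|exact (is_line_Cmult _ _ (/ (- Ci * N)) LD)].
  intros x; cbv beta.
  rewrite RtoC_plus_half_Ci, RtoC_minus_half_Ci.
  replace (z + Ci / 2 - (x + Ci / 2)) with (z - x) by ring.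
  replace (z - Ci / 2 - (x - Ci / 2)) with (z - x) by ring.
  assert (R1 := MP_weight_raising lam phi n x Hl); fold N in R1.
  match goal with |- ?l = _ =>
    transitivity (/ (- Ci * N) * / (z - x) *
      (MP lam phi n (x + Ci / 2) * weight lam lam phi (x + Ci / 2)
       - MP lam phi n (x - Ci / 2) * weight lam lam phi (x - Ci / 2))); [ring|] end.
  rewrite R1, Nat.add_1_r; unfold Cdiv.
  transitivity (/ (- Ci * N) * (- Ci * N) * (MP (lam - 1 / 2) phi (S n) x * / (z - x)
    * omega (lam - 1 / 2) phi x)); [ring|].
  rewrite Cinv_l; [ring|].
  apply Cmult_neq_0; [|exact HN].
  intros E; apply HCi; replace Ci with (- - Ci) by ring; rewrite E; ring. }
rewrite HE; unfold T.
replace (RtoC (INR n) + 1) with N by (unfold N; rewrite S_INR, RtoC_plus; reflexivity).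
field; repeat split; auto.
Qed.

(** By the raising relation at lam + 1/2 the integrand is a multiple of a difference between the
    heights 1/2 and -1/2, and the two lines carry the same integral. *)
Lemma MP_orthogonal_1 (lam phi : R) (n : nat) : (0 < phi < PI)%R -> (0 < lam)%R ->
  is_line (fun x => MP lam phi (S n) x * omega lam phi x) 0.
Proof.
intros Hphi Hl.
destruct (weight_shift (- (1 / 2)) (1 / 2) (1 / 2) (- (1 / 2)) (lam + 1 / 2) (lam + 1 / 2)
  phi _ Hphi ltac:(lra) ltac:(lra)
  (tame_MP (- (1 / 2)) (1 / 2) (lam + 1 / 2) phi n) ltac:(lra) ltac:(lra)) as [l [H1 H2]].
assert (LD := is_line_minus _ _ _ _ H1 H2).
set (N := RtoC (INR (S n))).
assert (HN : N <> 0) by (apply INR_neq_0_C; lia).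
assert (HCN : - Ci * N <> 0).
{ apply Cmult_neq_0; [|exact HN]; intros E; injection E; lra. }
replace (0 : C) with (/ (- Ci * N) * (l - l)) by ring.
eapply is_line_ext; [|exact (is_line_Cmult _ _ (/ (- Ci * N)) LD)].
intros x; cbv beta.
rewrite RtoC_plus_half_Ci, RtoC_minus_half_Ci.
rewrite MP_weight_raising by lra; fold N.
replace (lam + 1 / 2 - 1 / 2)%R with lam by ring.
transitivity (/ (- Ci * N) * (- Ci * N) * (MP lam phi (S n) x * omega lam phi x)); [ring|].
rewrite Cinv_l by exact HCN; ring.
Qed.

(** The reciprocal form stays valid where omega has a pole at z + i/2: both sides are then 0. *)
Lemma inv_omega_plus_half (lam phi : R) (z : C) :
  / omega lam phi (z + Ci / 2) =
  Ci * Cexp (- (Ci * phi)) * ((lam - 1 / 2)%R + Ci * z) * / omega (lam + 1 / 2) phi z.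
Proof.
rewrite !omega_weight, weight_plus_half, !Cinv_mult_total, weight_inv_succ_l.
replace (lam - 1 / 2 + 1)%R with (lam + 1 / 2)%R by field.
rewrite Cexp_opp; replace (/ - Ci) with Ci; [ring|].
apply injective_projections; simpl; field.
Qed.

Lemma inv_omega_minus_half (lam phi : R) (z : C) :
  / omega lam phi (z - Ci / 2) =
  - Ci * Cexp (Ci * phi) * ((lam - 1 / 2)%R - Ci * z) * / omega (lam + 1 / 2) phi z.
Proof.
rewrite !omega_weight, weight_minus_half, !Cinv_mult_total, weight_inv_succ_r.
replace (lam - 1 / 2 + 1)%R with (lam + 1 / 2)%R by field.
rewrite <- Cexp_opp; replace (- - (Ci * phi)) with (Ci * phi) by ring.
replace (/ Ci) with (- Ci); [ring|].
apply injective_projections; simpl; field.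
Qed.

(* The factor lam - 1/2 + i z of the Cauchy integral may be replaced by lam + i t: the
   difference is a multiple of z + i/2 - t and contributes the integral of
   [MP lam phi (S n)], which vanishes. *)
Lemma omegaQ_plus_half (lam phi : R) (n : nat) (z : C) :
  (0 < phi < PI)%R -> (0 < lam)%R -> (1 / 2 < Rabs (Im z))%R ->
  is_line (fun x => MP lam phi (S n) (x + Ci / 2) * / (z - x) * omega (lam + 1 / 2) phi x)
    (Ci * Cexp (- (Ci * phi)) * ((lam - 1 / 2)%R + Ci * z)
       * omegaQ lam phi (S n) (z + Ci / 2)).
Proof.
intros Hphi Hl Hz.
assert (Hz' : (Im z < - (1 / 2) \/ 1 / 2 < Im z)%R)
  by (revert Hz; unfold Rabs; destruct (Rcase_abs (Im z)); lra).
assert (Ip : Im (z + Ci / 2) = (Im z + 1 / 2)%R) by (rewrite half_Ci; destruct z; reflexivity).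
set (w := z + Ci / 2) in *.
assert (L0 := omegaQ_shift 0 0 0 lam phi (S n) w Hphi
  ltac:(lra) ltac:(lra) ltac:(lra) ltac:(lra) ltac:(lra)).
destruct (weight_shift 0 (1 / 2) 0 (1 / 2) (lam + 1) lam phi _ Hphi ltac:(lra) ltac:(lra)
  (tame_MP_cauchy 0 (1 / 2) lam phi (S n) w ltac:(lra)) ltac:(lra) ltac:(lra))
  as [l [H1 H2]].
assert (LO := MP_orthogonal_1 lam phi n Hphi Hl).
assert (El : l = ((lam - 1 / 2)%R + Ci * z) * omegaQ lam phi (S n) w).
{ transitivity (((lam - 1 / 2)%R + Ci * z) * omegaQ lam phi (S n) w - Ci * 0); [|ring].
  rewrite <- (is_line_unique _ _ H1); apply is_line_unique.
  refine (is_line_ext _ _ _ _ (is_line_minus _ _ _ _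
    (is_line_Cmult _ _ ((lam - 1 / 2)%R + Ci * z) L0) (is_line_Cmult _ _ Ci LO))).
  intros x; cbv beta; change (x, 0%R) with (RtoC x).
  rewrite weight_succ_l by apply (real_param_neq_0 lam x Hl).
  rewrite omega_weight.
  assert (Hw : w - x <> 0).
  { intros E; assert (E2 : Im (w - x) = 0%R) by now rewrite E.
    replace (Im (w - x)) with (Im w) in E2 by (destruct w; simpl; ring); lra. }
  replace (lam + Ci * x) with ((lam - 1 / 2)%R + Ci * z - Ci * (w - x)).
  2: { assert (E := Ci_half_mul z); fold w in E.
       transitivity ((lam - 1 / 2)%R + Ci * z - Ci * w + Ci * x); [ring|].
       rewrite E, RtoC_minus; ring. }
  set (W := weight lam lam phi x); set (p := MP lam phi (S n) x).
  field; exact Hw. }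
rewrite <- Cmult_assoc, <- El.
refine (is_line_ext _ _ _ _ (is_line_Cmult _ _ (Ci * Cexp (- (Ci * phi))) H2)).
intros x; cbv beta; rewrite RtoC_plus_half_Ci, weight_plus_half, omega_weight.
replace (lam + 1 - 1 / 2)%R with (lam + 1 / 2)%R by field.
replace (w - (x + Ci / 2)) with (z - x) by (unfold w; ring).
set (W := weight _ _ _ _); set (p := MP _ _ _ _).
assert (H := Cexp_mul_opp (Ci * phi)).
transitivity (- (Ci * Ci) * (Cexp (Ci * phi) * Cexp (- (Ci * phi))) * (p * / (z - x) * W));
  [ring | rewrite H, Ci_sq; ring].
Qed.

Lemma omegaQ_minus_half (lam phi : R) (n : nat) (z : C) :
  (0 < phi < PI)%R -> (0 < lam)%R -> (1 / 2 < Rabs (Im z))%R ->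
  is_line (fun x => MP lam phi (S n) (x - Ci / 2) * / (z - x) * omega (lam + 1 / 2) phi x)
    (- Ci * Cexp (Ci * phi) * ((lam - 1 / 2)%R - Ci * z)
       * omegaQ lam phi (S n) (z - Ci / 2)).
Proof.
intros Hphi Hl Hz.
assert (Hz' : (Im z < - (1 / 2) \/ 1 / 2 < Im z)%R)
  by (revert Hz; unfold Rabs; destruct (Rcase_abs (Im z)); lra).
assert (Ip : Im (z - Ci / 2) = (Im z - 1 / 2)%R) by (rewrite half_Ci; destruct z; reflexivity).
set (w := z - Ci / 2) in *.
assert (L0 := omegaQ_shift 0 0 0 lam phi (S n) w Hphi
  ltac:(lra) ltac:(lra) ltac:(lra) ltac:(lra) ltac:(lra)).
(* Below the axis the pole to be removed is that of Gamma(lam - i t) at t = -i lam, so the second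
   parameter is the one raised to [lam + 1]. *)
destruct (weight_shift (- (1 / 2)) 0 0 (- (1 / 2)) lam (lam + 1) phi _ Hphi
  ltac:(lra) ltac:(lra)
  (tame_MP_cauchy (- (1 / 2)) 0 lam phi (S n) w ltac:(lra)) ltac:(lra) ltac:(lra))
  as [l [H1 H2]].
assert (LO := MP_orthogonal_1 lam phi n Hphi Hl).
assert (El : l = ((lam - 1 / 2)%R - Ci * z) * omegaQ lam phi (S n) w).
{ transitivity (((lam - 1 / 2)%R - Ci * z) * omegaQ lam phi (S n) w + Ci * 0); [|ring].
  rewrite <- (is_line_unique _ _ H1); apply is_line_unique.
  refine (is_line_ext _ _ _ _ (is_line_plus _ _ _ _
    (is_line_Cmult _ _ ((lam - 1 / 2)%R - Ci * z) L0) (is_line_Cmult _ _ Ci LO))).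
  intros x; cbv beta; change (x, 0%R) with (RtoC x).
  rewrite weight_succ_r by apply (real_param_neq_0 lam x Hl).
  rewrite omega_weight.
  assert (Hw : w - x <> 0).
  { intros E; assert (E2 : Im (w - x) = 0%R) by now rewrite E.
    replace (Im (w - x)) with (Im w) in E2 by (destruct w; simpl; ring); lra. }
  replace (lam - Ci * x) with ((lam - 1 / 2)%R - Ci * z + Ci * (w - x)).
  2: { assert (E := Ci_half_mul_minus z); fold w in E.
       transitivity ((lam - 1 / 2)%R - Ci * z + Ci * w - Ci * x); [ring|].
       rewrite E, RtoC_minus; ring. }
  set (W := weight lam lam phi x); set (p := MP lam phi (S n) x).
  field; exact Hw. }
rewrite <- Cmult_assoc, <- El.
refine (is_line_ext _ _ _ _ (is_line_Cmult _ _ (- Ci * Cexp (Ci * phi)) H2)).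
intros x; cbv beta; rewrite RtoC_minus_half_Ci, weight_minus_half, omega_weight.
replace (lam + 1 - 1 / 2)%R with (lam + 1 / 2)%R by field.
replace (w - (x - Ci / 2)) with (z - x) by (unfold w; ring).
set (W := weight _ _ _ _); set (p := MP _ _ _ _).
assert (H := Cexp_mul_opp (Ci * phi)).
transitivity (- (Ci * Ci) * (Cexp (Ci * phi) * Cexp (- (Ci * phi))) * (p * / (z - x) * W));
  [ring | rewrite H, Ci_sq; ring].
Qed.

(** The integrals of [omegaQ_plus_half] and [omegaQ_minus_half] share kernel and weight, so their
    difference involves only the polynomial identity [MP_lowering]. Their prefactors are exactly
    those by which [/ omega] changes under the two shifts. *)
Lemma Q_lowering (lam phi : R) (n : nat) (z : C) :
  (0 < phi < PI)%R -> (0 < lam)%R -> (1 / 2 < Rabs (Im z))%R ->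
  T (Q lam phi (S n)) z = (2 * sin phi)%R * Q (lam + 1 / 2) phi n z.
Proof.
intros Hphi Hl Hz.
assert (Lp := omegaQ_plus_half lam phi n z Hphi Hl Hz).
assert (Lm := omegaQ_minus_half lam phi n z Hphi Hl Hz).
assert (LD := is_line_minus _ _ _ _ Lp Lm).
assert (Hz' : (Im z < 0 \/ 0 < Im z)%R)
  by (revert Hz; unfold Rabs; destruct (Rcase_abs (Im z)); lra).
assert (L1 := is_line_Cmult _ _ (Ci * (2 * sin phi)%R)
  (omegaQ_shift 0 0 0 (lam + 1 / 2) phi n z Hphi
    ltac:(lra) ltac:(lra) ltac:(lra) ltac:(lra) Hz')).
assert (E : Ci * (2 * sin phi)%R * omegaQ (lam + 1 / 2) phi n z =
  Ci * Cexp (- (Ci * phi)) * ((lam - 1 / 2)%R + Ci * z) * omegaQ lam phi (S n) (z + Ci / 2)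
  - - Ci * Cexp (Ci * phi) * ((lam - 1 / 2)%R - Ci * z) * omegaQ lam phi (S n) (z - Ci / 2)).
{ rewrite <- (is_line_unique _ _ L1); apply is_line_unique.
  refine (is_line_ext _ _ _ _ LD).
  intros x; cbv beta; change (x, 0%R) with (RtoC x); rewrite <- omega_weight.
  assert (H := MP_lowering lam phi n x).
  set (o := omega _ _ _).
  transitivity ((MP lam phi (S n) (x + Ci / 2) - MP lam phi (S n) (x - Ci / 2))
    * / (z - x) * o); [ring | rewrite H; ring]. }
unfold T, Q, Cdiv; rewrite inv_omega_plus_half, inv_omega_minus_half.
set (o := / omega (lam + 1 / 2) phi z).
match goal with |- (?u1 * ?v1 - ?u2 * ?v2) * / Ci = _ =>
  transitivity ((Ci * (2 * sin phi)%R * omegaQ (lam + 1 / 2) phi n z) * o * / Ci) end.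
- rewrite E; unfold Cdiv; ring.
- assert (HCi : Ci <> 0) by (intros E0; injection E0; lra).
  field; exact HCi.
Qed.

(** * Regular points of the weight *)

Lemma omega_neq_0 (lam phi : R) (z : C) : omega_regular lam z -> omega lam phi z <> 0.
Proof.
intros H; unfold omega.
repeat apply Cmult_neq_0; [apply Cexp_neq_0 | |]; apply Gamma_neq_0; intros k; apply H.
Qed.

Lemma neg_nat_pred (a : C) : (forall k : nat, a <> - INR k) -> forall k : nat, a + 1 <> - INR k.
Proof.
intros H k E; apply (H (S k)); rewrite S_INR, RtoC_plus.
replace a with (a + 1 - 1) by ring; rewrite E; ring.
Qed.

(** The Gamma arguments at the two shifted points are those at z for lam - 1/2, unchanged or
    increased by 1. *)
Lemma omega_regular_half (lam : R) (z : C) : omega_regular (lam - 1 / 2) z ->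
  omega_regular lam (z + Ci / 2) /\ omega_regular lam (z - Ci / 2).
Proof.
intros H.
assert (Ha := neg_nat_pred _ (fun k => proj1 (H k))).
assert (Hb := neg_nat_pred _ (fun k => proj2 (H k))).
split; intros k; rewrite ?Ci_half_mul, ?Ci_half_mul_minus; split.
- intros E; apply (proj1 (H k)); rewrite <- E, RtoC_minus; ring.
- intros E; apply (Hb k); rewrite <- E, RtoC_minus, one_half_half; ring.
- intros E; apply (Ha k); rewrite <- E, RtoC_minus, one_half_half; ring.
- intros E; apply (proj2 (H k)); rewrite <- E, RtoC_minus; ring.
Qed.

Lemma omega_Q (lam phi : R) (n : nat) (z : C) : omega_regular lam z ->
  omega lam phi z * Q lam phi n z = omegaQ lam phi n z.
Proof.
intros H; unfold Q; assert (H0 := omega_neq_0 lam phi z H); field; exact H0.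
Qed.

(** The raising relation occurs in two forms: for the literal product where omega(z; lam - 1/2) is
    regular, and for [omegaQ], which covers the removable singularities too. *)
Theorem mainTheorem10 :
  forall lam phi : R, (0 < phi < PI)%R -> (0 < lam)%R ->
    (forall (n : nat) (z : C),
       (1 <= n)%nat -> (1 / 2 < Rabs (Im z))%R ->
       T (Q lam phi n) z
       = (2 * sin phi)%R * Q (lam + 1 / 2) phi (n - 1) z)
    /\
    (forall (n : nat) (z : C),
       (1 / 2 < lam)%R -> (1 / 2 < Rabs (Im z))%R ->
       omega_regular (lam - 1 / 2) z ->
       T (fun w => omega lam phi w * Q lam phi n w) z
       = - (INR n + 1) *
           (omega (lam - 1 / 2) phi z * Q (lam - 1 / 2) phi (n + 1) z))
    /\
    (forall (n : nat) (z : C),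
       (1 / 2 < lam)%R -> (1 / 2 < Rabs (Im z))%R ->
       T (omegaQ lam phi n) z
       = - (INR n + 1) * omegaQ (lam - 1 / 2) phi (n + 1) z).
Proof.
intros lam phi Hphi Hlam; split; [|split].
- intros [|n] z Hn Hz; [lia|].
  replace (S n - 1)%nat with n by lia; now apply Q_lowering.
- intros n z Hl Hz Hreg.
  destruct (omega_regular_half lam z Hreg) as [Hp Hm].
  rewrite (omega_Q (lam - 1 / 2) phi (n + 1) z Hreg), <- omegaQ_raising by assumption.
  unfold T; rewrite !omega_Q by assumption; reflexivity.
- intros n z Hl Hz; now apply omegaQ_raising.
Qed.
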